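(* Let $\phi\colon Q^n\to Q^n$ be a $Q$-linear transformation. Then $\widetilde{\mathrm{ent}}_v(\phi)=v(s)$, where $s\in R$ is the leading coefficient of the characteristic polynomial of $\phi$ over $R$.
   Context: $R$ is a non-discrete archimedean valuation domain: a valuation domain with field of fractions $Q$ and valuation $v\colon Q\to\Gamma(R)\cup\{\infty\}$ whose value group $\Gamma(R)$ is a dense subgroup of the ordered additive group $\mathbb R$. Put $\mathbb R^*=\mathbb R_{\ge 0}\cup\{\infty\}$. For a $Q$-linear $\phi\colon Q^n\to Q^n$ let $p_\phi(X)\in Q[X]$ be the monic characteristic polynomial of $\phi$ over $Q$. Since $R$ is a valuation domain there is an element $s\in R$ of minimal value such that $s\,p_\phi(X)\in R[X]$; the polynomial $s\,p_\phi(X)$ is primitive (its content is $R$), has leading coefficient $s$, and is called the characteristic polynomial of $\phi$ over $R$. A length function on $\mathrm{Mod}(R)$ is a function $L\colon\mathrm{Mod}(R)\to\mathbb R^*$ with $L(0)=0$, invariant under isomorphism, additive on short exact sequences, and with $L(M)=\sup\{L(F):F\le M\text{ finitely generated}\}$. $L_v$ denotes the (unique) length function on $\mathrm{Mod}(R)$ with $L_v(R/I)=\inf_{r\in I}v(r)$ for every ideal $I$ of $R$ (Northcott–Reufel). For an $R$-module $M$, $\phi\in\mathrm{End}_R(M)$, an $R$-submodule $K\le M$ and $n\ge1$, $T_n(\phi,K)=K+\phi K+\dots+\phi^{n-1}K$. An $R$-submodule $H\le M$ is $\phi$-inert if $L_v((H+\phi H)/H)<\infty$; $\mathcal I_\phi(M)$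 is the set of $\phi$-inert submodules. For $H\in\mathcal I_\phi(M)$, $\widetilde{\mathrm{ent}}_v(\phi,H)=\lim_{n\to\infty}\frac{L_v(T_n(\phi,H)/H)}{n}$ (the limit exists and is finite), and $\widetilde{\mathrm{ent}}_v(\phi)=\sup_{H\in\mathcal I_\phi(M)}\widetilde{\mathrm{ent}}_v(\phi,H)$. Here $Q^n$ is regarded as an $R$-module. *)

(* Defs.v *)
From HB Require Import structures.
From mathcomp Require Import all_boot all_order all_algebra.
From mathcomp Require Import boolp classical_sets reals constructive_ereal ereal.
From mathcomp Require Import topology normedtype sequences.

Set Implicit Arguments.
Unset Strict Implicit.
Unset Printing Implicit Defensive.

Import Order.TTheory GRing.Theory Num.Theory.
Import numFieldNormedType.Exports.

Local Open Scope classical_set_scope.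
Local Open Scope ring_scope.
Local Open Scope ereal_scope.
Local Open Scope quotient_scope.
Local Open Scope ring_scope.

(* Submodules of M are the elements of [submodClosed M].  Membership is boolean,
   so submodules given by a proposition are built with [asbool]. *)

Section SubmoduleType.
Variables (R : pzRingType) (M : lmodType R) (H : submodClosed M).

Definition submod := {x : M | x \in H}.

HB.instance Definition _ := SubChoice.on submod.
HB.instance Definition _ := [SubChoice_isSubLmodule of submod by <:].

End SubmoduleType.

Section QuotientModule.
Variables (R : pzRingType) (M : lmodType R) (N : submodClosed M).

(* [submodClosed M] does not record closure under opposites, which the quotient
   of the underlying additive group requires. *)
Definition submod_group : {pred M} := N.

Fact submod_group_closed : zmod_closed submod_group.
Proof. exact: GRing.subsemimod_closedB (GRing.subsemimodClosedP N). Qed.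

HB.instance Definition _ :=
  GRing.isZmodClosed.Build M submod_group submod_group_closed.

Definition quotmod := Quotient.quot submod_group.

HB.instance Definition _ := GRing.Zmodule.on quotmod.
HB.instance Definition _ := EqQuotient.on quotmod.

Definition quotmod_scale (a : R) (x : quotmod) : quotmod :=
  \pi_quotmod (a *: repr x).

Lemma quotmod_eqP (x y : M) :
  reflect (\pi_quotmod x = \pi_quotmod y) (x - y \in N).
Proof.
apply: (equivP idP); split=> [xyN|/eqP xyN].
  by apply/eqP; rewrite -[_ == _](Quotient.idealrBE submod_group).
by rewrite -[_ == _](Quotient.idealrBE submod_group) in xyN.
Qed.

Lemma pi_quotmodD (x y : M) :
  \pi_quotmod (x + y) = \pi_quotmod x + \pi_quotmod y.
Proof. exact: (@Quotient.pi_add M submod_group). Qed.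

Lemma pi_quotmodZ (a : R) (x : M) :
  \pi_quotmod (a *: x) = quotmod_scale a (\pi_quotmod x).
Proof.
apply/quotmod_eqP; rewrite -scalerBr rpredZ//.
by apply/quotmod_eqP; rewrite reprK.
Qed.

Fact quotmod_scaleA a b x :
  quotmod_scale a (quotmod_scale b x) = quotmod_scale (a * b) x.
Proof. by rewrite -[x]reprK -(pi_quotmodZ b) -!pi_quotmodZ scalerA. Qed.

Fact quotmod_scale1 : left_id 1 quotmod_scale.
Proof. by move=> x; rewrite -[x]reprK -pi_quotmodZ scale1r. Qed.

Fact quotmod_scaleDr : right_distributive quotmod_scale +%R.
Proof.
move=> a x y; rewrite -[x]reprK -[y]reprK -pi_quotmodD -!pi_quotmodZ.
by rewrite scalerDr pi_quotmodD.
Qed.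

Fact quotmod_scaleDl x :
  {morph quotmod_scale^~ x : a b / a + b}.
Proof.
by move=> a b; rewrite -[x]reprK -!pi_quotmodZ scalerDl pi_quotmodD.
Qed.

HB.instance Definition _ := GRing.Zmodule_isLmodule.Build R quotmod
  quotmod_scaleA quotmod_scale1 quotmod_scaleDr quotmod_scaleDl.

End QuotientModule.

Section SubmoduleOperations.
Variables (R : pzRingType) (M : lmodType R).

Definition submod0_pred : {pred M} := pred1 0.

Fact submod0_closed : subsemimod_closed submod0_pred.
Proof.
split; first split.
- by rewrite inE.
- by move=> x y /eqP-> /eqP->; rewrite addr0 inE.
- by move=> a x /eqP->; rewrite scaler0 inE.
Qed.

HB.instance Definition _ :=
  GRing.isSubmodClosed.Build R M submod0_pred submod0_closed.

Definition submod0 : submodClosed M := submod0_pred.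

Definition submod_add_pred (A B : submodClosed M) : {pred M} :=
  fun x => `[< exists a b, [/\ a \in A, b \in B & x = a + b] >].

Fact submod_add_closed A B : subsemimod_closed (submod_add_pred A B).
Proof.
split; first split.
- by apply/asboolP; exists 0, 0; rewrite !rpred0 addr0.
- move=> _ _ /asboolP[a [b [aA bB ->]]] /asboolP[c [d [cA dB ->]]].
  by apply/asboolP; exists (a + c), (b + d); rewrite !rpredD// addrACA.
- move=> k _ /asboolP[a [b [aA bB ->]]].
  by apply/asboolP; exists (k *: a), (k *: b); rewrite !rpredZ// scalerDr.
Qed.

HB.instance Definition _ A B :=
  GRing.isSubmodClosed.Build R M (submod_add_pred A B) (submod_add_closed A B).

Definition submod_add (A B : submodClosed M) : submodClosed M :=
  submod_add_pred A B.

Definition submod_im_pred (phi : {linear M -> M}) (A : submodClosed M) :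
    {pred M} :=
  fun x => `[< exists2 a, a \in A & x = phi a >].

Fact submod_im_closed phi A : subsemimod_closed (submod_im_pred phi A).
Proof.
split; first split.
- by apply/asboolP; exists 0; rewrite ?rpred0 ?linear0.
- move=> _ _ /asboolP[a aA ->] /asboolP[b bA ->].
  by apply/asboolP; exists (a + b); rewrite ?rpredD ?linearD.
- move=> k _ /asboolP[a aA ->].
  by apply/asboolP; exists (k *: a); rewrite ?rpredZ ?linearZ.
Qed.

HB.instance Definition _ phi A :=
  GRing.isSubmodClosed.Build R M (submod_im_pred phi A) (submod_im_closed phi A).

Definition submod_im (phi : {linear M -> M}) (A : submodClosed M) :
    submodClosed M :=
  submod_im_pred phi A.

Definition submod_in_pred (A B : submodClosed M) : {pred submod A} :=
  fun x => val x \in B.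

Fact submod_in_closed A B : subsemimod_closed (@submod_in_pred A B).
Proof.
split; first split.
- by rewrite unfold_in raddf0 rpred0.
- by move=> x y xB yB; rewrite unfold_in raddfD rpredD.
- by move=> k x xB; rewrite unfold_in linearZ rpredZ.
Qed.

HB.instance Definition _ A B :=
  GRing.isSubmodClosed.Build R (submod A) (@submod_in_pred A B)
    (submod_in_closed A B).

(* The module A / (A ∩ B); only used when B is contained in A, for A / B. *)
Definition subquot (A B : submodClosed M) : lmodType R :=
  quotmod (@submod_in_pred A B : submodClosed (submod A)).

Definition finitely_generated (F : submodClosed M) : Prop :=
  exists (m : nat) (g : 'I_m -> M), forall x,
    x \in F <-> exists c : 'I_m -> R, x = \sum_(i < m) c i *: g i.

(* T_n(phi, H) = H + phi H + ... + phi^(n-1) H *)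
Definition partial_trajectory (phi : {linear M -> M}) (H : submodClosed M)
    (n : nat) : submodClosed M :=
  \big[submod_add/submod0]_(i < n) iter i (submod_im phi) H.

End SubmoduleOperations.

Section LengthFunctions.
Variables (R : pzRingType) (K : realType).

Record is_length_function (L : lmodType R -> \bar K) : Prop := {
  length_ge0 : forall M, (0 <= L M)%E;
  length_zero : forall M : lmodType R, (forall x : M, x = 0) -> L M = 0%E;
  length_iso : forall (M N : lmodType R) (f : {linear M -> N}),
    bijective f -> L M = L N;
  length_exact : forall (A B C : lmodType R)
      (f : {linear A -> B}) (g : {linear B -> C}),
    injective f -> (forall c, exists b, g b = c) ->
    (forall b, g b = 0 <-> exists a, f a = b) ->
    L B = (L A + L C)%E;
  length_sup : forall M : lmodType R,
    L M = ereal_sup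
      [set L (submod F) | F in [set F : submodClosed M | finitely_generated F]]
}.

Variables (L : lmodType R -> \bar K) (M : lmodType R) (phi : {linear M -> M}).

Definition inert (H : submodClosed M) : Prop :=
  (L (subquot (submod_add H (submod_im phi H)) H) < +oo)%E.

Definition intrinsic_entropy_at (H : submodClosed M) : \bar K :=
  limn (fun n : nat =>
    (L (subquot (partial_trajectory phi H n) H) * (n%:R^-1)%:E)%E).

Definition intrinsic_entropy : \bar K :=
  ereal_sup [set intrinsic_entropy_at H | H in [set H | inert H]].

End LengthFunctions.

Section Valuations.
Variables (R : idomainType) (K : realType).

Definition value_group (v : {fraction R} -> \bar K) : set K :=
  [set g | exists x, v x = g%:E].

(* The value +oo is taken at 0 only.  That R is a valuation domain follows from
   [valuation_ring], archimedean from the values being real, and non-discrete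
   from [valuation_dense]. *)
Record is_nondiscrete_archimedean_valuation (v : {fraction R} -> \bar K) :
    Prop := {
  valuation_notNy : forall x, v x != -oo%E;
  valuation_infty : forall x, v x = +oo%E <-> x = 0;
  valuationM : forall x y : {fraction R}, v (x * y) = (v x + v y)%E;
  valuationD : forall x y : {fraction R}, (Order.min (v x) (v y) <= v (x + y)%R)%E;
  valuation_ring : forall x,
    (0 <= v x)%E <-> exists r : R, x = tofrac r;
  valuation_dense : dense (value_group v)
}.

(* By Northcott and Reufel exactly one L satisfies this; an ideal of R is a
   submodule of the regular module. *)
Definition is_valuation_length (v : {fraction R} -> \bar K)
    (L : lmodType R -> \bar K) : Prop :=
  is_length_function L /\
  forall I : submodClosed R^o,
    L (quotmod I) = ereal_inf 
      [set v (tofrac (r : R)) | r in [set r : R | r \in I]].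

End Valuations.

Section RestrictionOfScalars.
Variables (R : idomainType) (n : nat).

(* Q^n with its R-module structure; an alias, because 'rV[Q]_n already carries
   its structure of Q-vector space. *)
Definition fracpow := 'rV[{fraction R}]_n.

HB.instance Definition _ := GRing.Zmodule.on fracpow.

Definition fracpow_scale (a : R) (x : fracpow) : fracpow :=
  tofrac a *: (x : 'rV[{fraction R}]_n).

Fact fracpow_scaleA a b x :
  fracpow_scale a (fracpow_scale b x) = fracpow_scale (a * b) x.
Proof. by rewrite /fracpow_scale scalerA -rmorphM. Qed.

Fact fracpow_scale1 : left_id 1 fracpow_scale.
Proof. by move=> x; rewrite /fracpow_scale rmorph1 scale1r. Qed.

Fact fracpow_scaleDr : right_distributive fracpow_scale +%R.
Proof. by move=> a x y; rewrite /fracpow_scale scalerDr. Qed.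

Fact fracpow_scaleDl x : {morph fracpow_scale^~ x : a b / a + b}.
Proof. by move=> a b; rewrite /fracpow_scale rmorphD scalerDl. Qed.

HB.instance Definition _ := GRing.Zmodule_isLmodule.Build R fracpow
  fracpow_scaleA fracpow_scale1 fracpow_scaleDr fracpow_scaleDl.

Variable phi : {linear 'rV[{fraction R}]_n -> 'rV[{fraction R}]_n}.

Definition fracpow_fun : fracpow -> fracpow := phi.

Fact fracpow_fun_linear : linear fracpow_fun.
Proof. by move=> a x y; rewrite /fracpow_fun (linearP phi). Qed.

HB.instance Definition _ :=
  GRing.isLinear.Build R fracpow fracpow _ fracpow_fun fracpow_fun_linear.

Definition restrict_scalars : {linear fracpow -> fracpow} := fracpow_fun.

End RestrictionOfScalars.

Section CharacteristicPolynomial.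
Variables (R : idomainType) (K : realType) (v : {fraction R} -> \bar K).
Variables (n : nat).
Variable phi : {linear 'rV[{fraction R}]_n -> 'rV[{fraction R}]_n}.

(* p = s p_phi in R[X].  [lin1_mx phi] is the matrix of phi acting on rows, the
   transpose of the usual one, which has the same characteristic polynomial. *)
Definition scaled_char_poly (s : R) (p : {poly R}) : Prop :=
  map_poly (@tofrac R) p =
    tofrac s *: char_poly (lin1_mx phi).

(* s, and hence p, is determined up to a unit of R. *)
Definition is_char_poly_over (p : {poly R}) : Prop :=
  exists s : R, scaled_char_poly s p /\
    forall (t : R) (q : {poly R}), scaled_char_poly t q ->
      (v (tofrac s) <= v (tofrac t))%E.

End CharacteristicPolynomial.

(* Main.v *)
Require Import Defs.
From HB Require Import structures.
From mathcomp Require Import all_boot all_order all_algebra.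
From mathcomp Require Import boolp classical_sets reals constructive_ereal ereal.
From mathcomp Require Import topology normedtype sequences.
From mathcomp Require Import zify.

Set Implicit Arguments.
Unset Strict Implicit.
Unset Printing Implicit Defensive.

Import Order.TTheory GRing.Theory Num.Theory.
Import numFieldNormedType.Exports.
Local Open Scope quotient_scope.
Local Open Scope ring_scope.

(** Write [T_k] for the [k]-th partial trajectory of a submodule [H] and
    [ell A B] for the length of [A / (A ∩ B)].  Since [phi] maps
    [T_(k+1) / T_k] onto [T_(k+2) / T_(k+1)], the growth [ell T_(k+1) T_k] is
    nonincreasing, and the entropy at an inert [H] is its limit
    ([ell_traj_step], [intrinsic_entropy_atE]).

    One good lattice computes everything.  Filter [Q^n] by invariant subspaces
    with cyclic quotients [Q[X]/(f_i)], generated by the class of [y_i], and let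
    [q_i] be the primitive multiple of [f_i] in [R[X]].  After rescaling [y_i],
    [q_i(phi) y_i] lies in the lattice [E_(i-1)] already built, and
    [E_i := E_(i-1) + sum_(j < deg q_i) R phi^j y_i].  By Gauss's lemma a
    polynomial over [R] that kills [y_i] modulo the smaller subspace is a
    multiple of [q_i] in [R[X]].  Hence passing from [E_(i-1)] to [E_i]
    contributes to every [T_(k+1) / T_k], for [k] positive, exactly one
    new cyclic layer [R / lc(q_i) R] ([ell_traj_ext]).  The product of the [q_i]
    is primitive and proportional to the characteristic polynomial, so the
    final lattice [E] has constant growth [v s] ([adapted_full],
    [lead_char_poly_value]).  It is inert, which gives the lower bound.

    For the upper bound, let [H] be inert and [e] positive.  Because lengths are
    approximated by finitely generated submodules, some finitely generated [F]
    inside [H] has [ell (H + phi H) (H + phi F) <= e], and then the trajectory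
    of [H] exceeds [H + T_k F] by at most [k e] ([ell_traj_core]).  On the other
    hand [F] lies in [d^-1 E] for some nonzero [d], and [c E] meets the
    [Q]-span of [H], which is invariant because [H] is inert, inside [H] for
    some nonzero [c]; so [ell (T_k F) H] is at most [ell (T_k E) E] plus a
    constant ([ell_traj_lattice]).  Dividing by [k] bounds the entropy at [H]
    by [v s + e]. *)

(** * Subquotients and the comparison of their lengths *)

Lemma submodB (R : pzRingType) (M : lmodType R) (A : submodClosed M) x y :
  x \in A -> y \in A -> x - y \in A.
Proof. by move=> xA yA; rewrite -scaleN1r rpredD// rpredZ. Qed.

(** Elements of [subquot A B] are classes of representatives in [M]; through
    [cls] and [rep] the nested subtype and quotient need not be opened again. *)
Section QuotientClasses.
Variables (R : pzRingType) (M : lmodType R) (A B : submodClosed M).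

Definition cls (x : M) : subquot A B :=
  \pi_(quotmod (@submod_in_pred R M A B : submodClosed (submod A)))
    (insubd (0 : submod A) x).

Definition rep (z : subquot A B) : M := val (repr z : submod A).

Lemma rep_in z : rep z \in A.
Proof. exact: valP. Qed.

Lemma repK z : cls (rep z) = z.
Proof. by rewrite /cls /rep valKd reprK. Qed.

Lemma cls_eqP x y : x \in A -> y \in A -> (cls x = cls y <-> x - y \in B).
Proof.
move=> xA yA; rewrite /cls.
have := (@quotmod_eqP R (submod A) (@submod_in_pred R M A B : submodClosed _)
  (insubd (0 : submod A) x) (insubd (0 : submod A) y)).
rewrite [_ - _ \in _]/in_mem/= /submod_in_pred raddfB/= !insubdK// => h.
by split=> /h.
Qed.

Lemma clsD x y : x \in A -> y \in A -> cls (x + y) = cls x + cls y.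
Proof.
move=> xA yA; rewrite /cls -pi_quotmodD; congr \pi.
by apply: val_inj; rewrite raddfD/= !insubdK// rpredD.
Qed.

Lemma clsZ a x : x \in A -> cls (a *: x) = a *: cls x.
Proof.
move=> xA.
have e : insubd (0 : submod A) (a *: x) = a *: insubd (0 : submod A) x.
  by apply: val_inj; rewrite linearZ/= !insubdK// rpredZ.
by rewrite /cls e; exact: pi_quotmodZ.
Qed.

Lemma cls0P x : x \in A -> (cls x = 0 <-> x \in B).
Proof.
move=> xA; rewrite -{2}[x]subr0 -(cls_eqP xA (rpred0 A)).
suff -> : cls 0 = 0 by [].
by rewrite -(scale0r (0 : M)) clsZ ?rpred0// scale0r.
Qed.

End QuotientClasses.

Section LinearMaps.
Variables (R : pzRingType) (M N : lmodType R) (f : {linear M -> N}).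

Section Comap.
Variable B : submodClosed N.

Definition comap_pred : {pred M} := fun x => f x \in B.

Fact comap_closed : subsemimod_closed comap_pred.
Proof.
split; first split.
- by rewrite unfold_in raddf0 rpred0.
- by move=> x y xB yB; rewrite unfold_in raddfD rpredD.
- by move=> k x xB; rewrite unfold_in linearZ rpredZ.
Qed.

HB.instance Definition _ :=
  GRing.isSubmodClosed.Build R M comap_pred comap_closed.

Definition submod_comap : submodClosed M := comap_pred.

End Comap.

Definition range_pred : {pred N} := fun y => `[< exists x, f x = y >].

Fact range_closed : subsemimod_closed range_pred.
Proof.
split; first split.
- by apply/asboolP; exists 0; rewrite linear0.
- move=> _ _ /asboolP[x <-] /asboolP[y <-].
  by apply/asboolP; exists (x + y); rewrite linearD.
- by move=> k _ /asboolP[x <-]; apply/asboolP; exists (k *: x); rewrite linearZ.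
Qed.

HB.instance Definition _ :=
  GRing.isSubmodClosed.Build R N range_pred range_closed.

Definition submod_range : submodClosed N := range_pred.

End LinearMaps.

Lemma mem_submod_range (R : pzRingType) (M N : lmodType R) (f : {linear M -> N})
    y :
  y \in submod_range f <-> exists x, f x = y.
Proof. by split=> [/asboolP|h]//; apply/asboolP. Qed.

Section Length.
Variables (R : pzRingType) (K : realType) (L : lmodType R -> \bar K).
Hypothesis hL : is_length_function L.

Lemma length_le_inj (M N : lmodType R) (f : {linear M -> N}) :
  injective f -> (L M <= L N)%E.
Proof.
move=> finj; pose Q := quotmod (submod_range f).
pose g (y : N) : Q := \pi y.
have glin : linear g.
  by move=> a x y; rewrite /g pi_quotmodD pi_quotmodZ.
pose G : {linear N -> Q} := HB.pack g (GRing.isLinear.Build _ _ _ _ _ glin).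
rewrite (length_exact hL (f := f) (g := G))//.
- by rewrite leeDl// length_ge0.
- by move=> c; exists (repr c); rewrite /= /g reprK.
- move=> b; rewrite -mem_submod_range -{2}[b]subr0; split=> [|/quotmod_eqP] h.
    by apply/quotmod_eqP; rewrite -[LHS]/(G b) h -(raddf0 G).
  by rewrite -(raddf0 G).
Qed.

Lemma length_le_surj (M N : lmodType R) (f : {linear M -> N}) :
  (forall y, exists x, f x = y) -> (L N <= L M)%E.
Proof.
move=> fsurj; pose A := submod (submod_comap f (submod0 N)).
pose g (x : A) : M := val x.
have glin : linear g by move=> a x y; rewrite /g linearP.
pose G : {linear A -> M} := HB.pack g (GRing.isLinear.Build _ _ _ _ _ glin).
rewrite (length_exact hL (f := G) (g := f))//.
- by rewrite leeDr// length_ge0.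
- exact: val_inj.
- move=> b; split=> [fb0|[a <-]].
    have bA : b \in submod_comap f (submod0 N) by apply/eqP.
    by exists (Sub b bA); rewrite /= /g SubK.
  by have /eqP := valP a.
Qed.

(** The length of [A / (A ∩ B)].  Letting [B] be arbitrary turns the second
    isomorphism theorem into the equality [ell_addr]. *)
Definition ell (M : lmodType R) (A B : submodClosed M) : \bar K :=
  L (subquot A B).

Lemma ell_ge0 (M : lmodType R) (A B : submodClosed M) : (0 <= ell A B)%E.
Proof. exact: length_ge0. Qed.

Section Compare.
Variables (M N : lmodType R) (f : {linear M -> N}).
Variables (A B : submodClosed M) (A' B' : submodClosed N).
Hypothesis fA : forall x, x \in A -> f x \in A'.

Definition subquot_map (z : subquot A B) : subquot A' B' := cls A' B' (f (rep
  z)).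

Hypothesis fB : forall x, x \in A -> x \in B -> f x \in B'.

Lemma subquot_mapE x : x \in A -> subquot_map (cls A B x) = cls A' B' (f x).
Proof.
move=> xA; apply/cls_eqP; rewrite ?fA ?rep_in// -raddfB; apply: fB.
  by rewrite submodB// rep_in.
by apply/(cls_eqP B (rep_in _) xA); rewrite repK.
Qed.

Lemma subquot_map_linear : linear subquot_map.
Proof.
move=> a y z; rewrite -[y]repK -[z]repK; have [yA zA] := (rep_in y, rep_in z).
rewrite -clsZ// -clsD ?rpredZ// !subquot_mapE ?rpredD ?rpredZ//.
by rewrite linearP clsD ?rpredZ ?fA// clsZ// fA.
Qed.

Lemma ell_le_surj :
  (forall y, y \in A' -> exists2 x, x \in A & y - f x \in B') ->
  (ell A' B' <= ell A B)%E.
Proof.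
move=> fsurj.
pose F : {linear subquot A B -> subquot A' B'} :=
  HB.pack subquot_map (GRing.isLinear.Build _ _ _ _ _ subquot_map_linear).
apply: (length_le_surj (f := F)) => y.
have [x xA] := fsurj _ (rep_in y); exists (cls A B x).
rewrite [LHS](subquot_mapE xA) -[RHS]repK.
by apply/esym/cls_eqP; rewrite ?rep_in ?fA.
Qed.

End Compare.

(** Killing the preimage of [B'] instead of [B] only shrinks the quotient of
    [A], and that smaller quotient embeds in [A' / (A' ∩ B')]. *)
Lemma ell_le_inj (M N : lmodType R) (f : {linear M -> N})
    (A B : submodClosed M) (A' B' : submodClosed N) :
  (forall x, x \in A -> f x \in A') ->
  (forall x, x \in A -> f x \in B' -> x \in B) ->
  (ell A B <= ell A' B')%E.
Proof.
move=> fA fB; pose C := submod_comap f B'.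
apply: (@le_trans _ _ (ell A C)).
  apply: (@ell_le_surj _ _ idfun) => //.
  by move=> x xA; exists x => //; rewrite subrr rpred0.
have fC x : x \in A -> x \in C -> f x \in B' by [].
pose F : {linear subquot A C -> subquot A' B'} :=
  HB.pack (@subquot_map _ _ f A C A' B')
    (GRing.isLinear.Build _ _ _ _ _ (subquot_map_linear fA fC)).
apply: (length_le_inj (f := F)) => y z.
rewrite -[y]repK -[z]repK; have [yA zA] := (rep_in y, rep_in z).
rewrite [F _](subquot_mapE fA fC yA) [F _](subquot_mapE fA fC zA).
move=> /(cls_eqP B' (fA _ yA) (fA _ zA)); rewrite -raddfB => h.
by apply/cls_eqP.
Qed.

Section Submodules.
Variable (M : lmodType R).
Implicit Types A B C D : submodClosed M.

Lemma ell_mono A A' B B' : (forall x, x \in A -> x \in A') ->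
  (forall x, x \in A -> x \in B' -> x \in B) -> (ell A B <= ell A' B')%E.
Proof. by move=> AA' BB'; exact: (@ell_le_inj _ _ idfun). Qed.

Lemma eq_ell A A' B B' : (forall x, x \in A <-> x \in A') ->
  (forall x, x \in A -> x \in B' <-> x \in B) -> ell A B = ell A' B'.
Proof.
move=> AA' BB'; apply/le_anti/andP; split; apply: ell_mono => x.
- by move/AA'.
- by move=> xA; case: (BB' x xA).
- by move/AA'.
- by move/AA' => xA; case: (BB' x xA).
Qed.

Lemma ell_sub0 A B : (forall x, x \in A -> x \in B) -> ell A B = 0%E.
Proof.
move=> AB; apply: (length_zero hL) => z; rewrite -[z]repK.
by apply/cls0P; [exact: rep_in|apply: AB; exact: rep_in].
Qed.

(** Additivity on [0 -> B / C -> A / C -> A / B -> 0]. *)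
Lemma ell_chain A B C : (forall x, x \in B -> x \in A) ->
  (forall x, x \in C -> x \in B) -> ell A C = (ell B C + ell A B)%E.
Proof.
move=> BA CB.
pose f := @subquot_map M M idfun B C A C.
have fC x : x \in B -> x \in C -> idfun x \in C by [].
pose F : {linear subquot B C -> subquot A C} :=
  HB.pack f (GRing.isLinear.Build _ _ _ _ _ (subquot_map_linear (f := idfun) BA
    fC)).
pose g := @subquot_map M M idfun A C A B.
have gA x : x \in A -> idfun x \in A by [].
have gC x : x \in A -> x \in C -> idfun x \in B by move=> _ /CB.
pose G : {linear subquot A C -> subquot A B} :=
  HB.pack g (GRing.isLinear.Build _ _ _ _ _ (subquot_map_linear (f := idfun) gA
    gC)).
have FE x : x \in B -> F (cls B C x) = cls A C x := @subquot_mapE _ _ idfun _ _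
  _ _ BA fC x.
have GE x : x \in A -> G (cls A C x) = cls A B x := @subquot_mapE _ _ idfun _ _
  _ _ gA gC x.
apply: (length_exact hL (f := F) (g := G)).
- move=> y z; rewrite -[y]repK -[z]repK; have [yB zB] := (rep_in y, rep_in z).
  rewrite !FE// => /(cls_eqP C (BA _ yB) (BA _ zB)) h.
  exact/cls_eqP.
- move=> c; exists (cls A C (rep c)).
  by rewrite GE ?rep_in// repK.
- move=> b; have bA := rep_in b; rewrite -{1}[b]repK GE//; split=> [/cls0P h|].
    by exists (cls B C (rep b)); rewrite FE ?repK//; exact: h.
  move=> [a e]; apply/cls0P => //.
  move: e; rewrite -[a]repK -[X in _ = X]repK; have aB := rep_in a.
  rewrite FE// => /(cls_eqP C (BA _ aB) bA)/CB h.
  by rewrite -[rep b](subKr (rep a)) submodB.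
Qed.

End Submodules.
End Length.

(** * Sums of submodules and partial trajectories *)

Section SubmoduleSums.
Variables (R : pzRingType) (M : lmodType R).
Implicit Types (A B H : submodClosed M) (phi : {linear M -> M}).

Lemma mem_submod_add A B x :
  x \in submod_add A B <-> exists a b, [/\ a \in A, b \in B & x = a + b].
Proof. by split=> [/asboolP|h]//; apply/asboolP. Qed.

Lemma mem_submod_im phi A x :
  x \in submod_im phi A <-> exists2 a, a \in A & x = phi a.
Proof. by split=> [/asboolP|h]//; apply/asboolP. Qed.

Lemma submod_addl A B x : x \in A -> x \in submod_add A B.
Proof.
by move=> xA; apply/mem_submod_add; exists x, 0;
  rewrite rpred0 addr0.
Qed.

Lemma submod_addr A B x : x \in B -> x \in submod_add A B.
Proof.
by move=> xB; apply/mem_submod_add; exists 0, x;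
  rewrite rpred0 add0r.
Qed.

Lemma mem_submod_sum (A : nat -> submodClosed M) k x :
  x \in (\big[@submod_add R M/submod0 M]_(i < k) A i : submodClosed M) <->
  exists2 h : nat -> M, (forall i, h i \in A i) & x = \sum_(i < k) h i.
Proof.
elim: k A x => [|k IH] A x.
  rewrite big_ord0; split=> [/eqP->|[h _ ->]].
    by exists (fun=> 0) => [i|]; rewrite ?rpred0// big_ord0.
  by rewrite big_ord0 rpred0.
rewrite big_ord_recl; split.
  move=> /mem_submod_add[a [b [aA bB ->]]].
  have [h hA ->] := (IH (fun i => A i.+1) b).1 bB.
  by exists (fun i => if i is j.+1 then h j else a) => [[]|]//;
    rewrite big_ord_recl.
move=> [h hA ->]; rewrite big_ord_recl; apply/mem_submod_add.
exists (h 0), (\sum_(i < k) h i.+1); split => //.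
by apply/(IH (fun i => A i.+1)); exists (fun i => h i.+1).
Qed.

Lemma mem_iter_im phi H i x :
  x \in iter i (submod_im phi) H <-> exists2 h, h \in H & x = iter i phi h.
Proof.
elim: i x => [|i IH] x; first by split=> [xH|[h hH ->]]//; exists x.
rewrite [iter _ _ _]iterS; split=>
  [/mem_submod_im[a /IH[h hH ->] ->]|[h hH ->]].
  by exists h.
by apply/mem_submod_im; exists (iter i phi h) => //; apply/IH; exists h.
Qed.

Lemma mem_traj phi H k x : x \in partial_trajectory phi H k <->
  exists2 h : nat -> M, (forall i, h i \in H) &
    x = \sum_(i < k) iter i phi (h i).
Proof.
rewrite /partial_trajectory (mem_submod_sum (fun i =>
  iter i (submod_im phi) H)).
split=> [[h hA ->]|[h hH ->]].
  have /choice[g gP] : forall i, exists y, y \in H /\ h i = iter i phi y.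
    by move=> i; have /mem_iter_im[y yH e] := hA i; exists y.
  exists g => [i|]; first by have [] := gP i.
  by apply: eq_bigr => i _; have [] := gP i.
by exists (fun i => iter i phi (h i)) => // i; apply/mem_iter_im; exists (h i).
Qed.

Lemma iter_linear phi i : {morph iter i phi : x y / x + y}.
Proof. by move=> x y; elim: i => //= i ->; rewrite linearD. Qed.

Lemma iter_linearZ phi i a x : iter i phi (a *: x) = a *: iter i phi x.
Proof. by elim: i => //= i ->; rewrite linearZ. Qed.

Lemma iter_linear0 phi i : iter i phi 0 = 0.
Proof. by elim: i => //= i ->; rewrite linear0. Qed.

(** Trajectories grow by peeling off the last summand here, and the first one
    in [traj_recl]; the second form exhibits [T_(k+1)] as [H + phi T_k]. *)
Lemma traj_recr phi H k x : x \in partial_trajectory phi H k.+1 <->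
  exists t h, [/\ t \in partial_trajectory phi H k,
    h \in H & x = t + iter k phi h].
Proof.
split=> [/mem_traj[h hH ->]|[t [y [/mem_traj[h hH ->] yH ->]]]].
  exists (\sum_(i < k) iter i phi (h i)), (h k); split=> //.
    by apply/mem_traj; exists h.
  by rewrite big_ord_recr.
apply/mem_traj; exists (fun i => if i == k then y else h i) => [i|].
  by case: ifP.
rewrite big_ord_recr/= eqxx; congr (_ + _).
by apply: eq_bigr => i _; rewrite ltn_eqF.
Qed.

Lemma traj_recl phi H k x : x \in partial_trajectory phi H k.+1 <->
  exists t h, [/\ t \in partial_trajectory phi H k, h \in H & x = h + phi t].
Proof.
split=> [/mem_traj[h hH ->]|[t [y [/mem_traj[h hH ->] yH ->]]]].
  exists (\sum_(i < k) iter i phi (h i.+1)), (h 0); split=> //.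
    by apply/mem_traj; exists (fun i => h i.+1).
  by rewrite big_ord_recl linear_sum.
apply/mem_traj; exists (fun i => if i is j.+1 then h j else y) => [[]|]//.
by rewrite big_ord_recl/= linear_sum.
Qed.

Lemma traj_mono1 phi H k x :
  x \in partial_trajectory phi H k -> x \in partial_trajectory phi H k.+1.
Proof.
by move=> xT; apply/traj_recr; exists x, 0;
  rewrite rpred0 iter_linear0 addr0.
Qed.

Lemma traj_base phi H k x : x \in H -> x \in partial_trajectory phi H k.+1.
Proof.
by move=> xH; apply/traj_recl; exists 0, x;
  rewrite rpred0 linear0 addr0.
Qed.

Lemma traj1 phi H x : x \in partial_trajectory phi H 1 <-> x \in H.
Proof.
split=> [|/traj_base//].
by move=> /mem_traj[h hH ->]; rewrite big_ord1 /=.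
Qed.

End SubmoduleSums.

Section TrajectorySums.
Variables (R : pzRingType) (M : lmodType R) (phi : {linear M -> M}).
Implicit Types (H : submodClosed M).

Lemma traj_iter H k i x : (i < k)%N -> x \in H ->
  iter i phi x \in partial_trajectory phi H k.
Proof.
move=> ik xH; apply/mem_traj; exists (fun j => if j == i then x else 0).
  by move=> j; case: ifP; rewrite ?rpred0.
rewrite (bigD1 (Ordinal ik))//= eqxx big1 ?addr0// => j ji.
rewrite ifN; first by rewrite iter_linear0.
by apply: contraNneq ji => e; apply/eqP/val_inj.
Qed.

Lemma traj_sub H H' k x : (forall y, y \in H -> y \in H') ->
  x \in partial_trajectory phi H k -> x \in partial_trajectory phi H' k.
Proof.
by move=> HH' /mem_traj[h hH ->]; apply/mem_traj; exists h => // i; exact: HH'.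
Qed.

End TrajectorySums.
(** * Lengths of sums, cyclic modules and finitely generated pieces *)
Section LengthSums.
Variables (R : pzRingType) (K : realType) (L : lmodType R -> \bar K).
Hypothesis hL : is_length_function L.
Variable M : lmodType R.
Implicit Types A B F H : submodClosed M.
Local Notation ell := (ell L).

Lemma ell_addr A B : ell (submod_add A B) B = ell A B.
Proof.
apply/le_anti/andP; split.
  apply: (@ell_le_surj _ _ _ hL _ _ idfun) => // [x|y].
    exact: submod_addl.
  by move=> /mem_submod_add[a [b [aA bB ->]]]; exists a;
    rewrite //= addrC addKr.
by apply: (ell_mono hL) => // x xA; exact: submod_addl.
Qed.

(** In the chain [(A + A') + B], [A + B], [B] the upper layer is a quotient
    of [A' / (A' ∩ B)]. *)
Lemma ell_submod_add A A' B : (ell (submod_add A A') B <= ell A B + ell A' B)%E.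
Proof.
rewrite -(ell_addr (submod_add A A')) -(ell_addr A).
rewrite (ell_chain hL (B := submod_add A B)).
- rewrite leeD2l//; apply: (@ell_le_surj _ _ _ hL _ _ idfun) =>
  [x xA|x _ xB|y] /=.
  + by apply/submod_addl/submod_addr.
  + exact: submod_addr.
  + move=> /mem_submod_add[_ [b [/mem_submod_add[a [a' [aA a'A ->]]] bB ->]]].
    exists a' => //; apply/mem_submod_add; exists a, b; split=> //.
    by rewrite addrAC addrK.
- move=> x /mem_submod_add[a [b [aA bB ->]]]; apply/mem_submod_add.
  by exists a, b; split=> //; exact: submod_addl.
- by move=> x; exact: submod_addr.
Qed.

Lemma ell_submod_sum (A : nat -> submodClosed M) B k :
  (ell (\big[@submod_add R M/submod0 M]_(i < k) A i : submodClosed M) B <=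
   \sum_(i < k) ell (A i) B)%E.
Proof.
elim: k A => [|k IH] A.
  rewrite !big_ord0 (ell_sub0 hL)// => x /eqP->; exact: rpred0.
rewrite !big_ord_recl; apply: (le_trans (ell_submod_add _ _ _)).
by rewrite leeD2l//; exact: (IH (fun i => A i.+1)).
Qed.

Section Cyclic.
Variable z : M.

Definition orbit_map (r : R^o) : M := (r : R) *: z.

Fact orbit_map_linear : linear orbit_map.
Proof. by move=> a x y; rewrite /orbit_map scalerDl -scalerA. Qed.

HB.instance Definition _ :=
  GRing.isLinear.Build R R^o M _ orbit_map orbit_map_linear.

Definition ann_mod (B : submodClosed M) : submodClosed R^o :=
  submod_comap orbit_map B.

Lemma mem_ann_mod B (r : R^o) : (r \in ann_mod B) = ((r : R) *: z \in B).
Proof. by []. Qed.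

(** A cyclic module is the quotient of the ring by the annihilator of its
    generator. *)
Lemma ell_cyclic A B : z \in A ->
  (forall x, x \in A -> exists r : R, x - r *: z \in B) ->
  ell A B = L (quotmod (ann_mod B)).
Proof.
move=> zA zgen; pose I := ann_mod B; pose Q := quotmod I.
have rzA (r : R) : r *: z \in A by rewrite rpredZ.
pose f (q : Q) : subquot A B := cls A B ((repr q : R) *: z).
have fE (r : R) : f (\pi_Q (r : R^o)) = cls A B (r *: z).
  apply/(cls_eqP _ (rzA _) (rzA _)); rewrite -scalerBl.
  have /quotmod_eqP : \pi_Q (repr (\pi_Q (r : R^o))) = \pi_Q (r : R^o).
    by rewrite reprK.
  by [].
have flin : linear f.
  move=> a x y; rewrite -[x]reprK -[y]reprK.
  have e : a *: \pi_Q (repr x) + \pi_Q (repr y) = \pi_Q (a *: repr x + repr y).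
    by rewrite pi_quotmodD pi_quotmodZ.
  by rewrite e !fE scalerDl -scalerA clsD ?rpredZ// [in LHS]clsZ.
pose F : {linear Q -> subquot A B} :=
  HB.pack f (GRing.isLinear.Build _ _ _ _ _ flin).
apply/le_anti/andP; split.
  apply: (length_le_surj hL (f := F)) => y.
  have [r rB] := zgen _ (rep_in y); exists (\pi_Q (r : R^o)).
  rewrite [LHS]fE -[RHS]repK; apply/(cls_eqP _ (rzA _) (rep_in _)).
  by rewrite -opprB -scaleN1r rpredZ.
apply: (length_le_inj hL (f := F)) => x y.
rewrite -[x]reprK -[y]reprK [F _]fE [F _ in RHS]fE.
move=> /(cls_eqP _ (rzA _) (rzA _)); rewrite -scalerBl => h.
by apply/quotmod_eqP; exact: h.
Qed.

End Cyclic.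

(** The supremum defining a length is approached by a finitely generated
    submodule of [A / (A ∩ B)].  Its generators are lifted to [A], and any [F]
    containing the lifts is as good. *)
Lemma ell_fg_approx A B (e : K) : (ell A B < +oo)%E -> 0 < e ->
  exists m (g : 'I_m -> M), (forall i, g i \in A) /\
    forall F : submodClosed M, (forall i, g i \in F) ->
      (ell A B <= ell F B + e%:E)%E.
Proof.
move=> fin e0.
have supfin : ell A B \is a fin_num by rewrite ge0_fin_numE// (ell_ge0 hL).
have := length_sup hL (subquot A B); rewrite -/(ell A B) => supE.
have sup2 := supfin; rewrite supE in sup2.
have := ub_ereal_sup_adherent e0 sup2; rewrite -supE.
move=> [_ [F' [m [g gP]] <-]] /ltW; rewrite leeBlDr// => leF.
exists m, (fun i => rep (g i)); split=> [i|F gF]; first exact: rep_in.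
rewrite (le_trans leF)// leeD2r// -(ell_addr F B).
have inFB (z : submod F') : rep (val z) \in submod_add F B.
  have /(gP _).1[c zE] := valP z.
  apply/mem_submod_add; exists (\sum_(i < m) c i *: rep (g i)).
  exists (rep (val z) - \sum_(i < m) c i *: rep (g i)); split.
  - by rewrite rpred_sum// => i _; rewrite rpredZ.
  - have sA : \sum_(i < m) c i *: rep (g i) \in A.
      by rewrite rpred_sum// => i _; rewrite rpredZ// rep_in.
    apply/(cls_eqP B (rep_in _) sA); rewrite repK zE.
    suff [] : \sum_(i < m) c i *: rep (g i) \in A /\
      \sum_(i < m) c i *: g i = cls A B (\sum_(i < m) c i *: rep (g i)) by [].
    apply: (big_rec2 (fun y x => x \in A /\ y = cls A B x)) =>
      [|i y x _ [xA ->]].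
      by rewrite rpred0; split=> //; apply/esym/cls0P; rewrite rpred0.
    by rewrite clsD ?clsZ ?rpredD ?rpredZ ?rep_in// repK.
  - by rewrite addrC subrK.
pose f (z : submod F') := cls (submod_add F B) B (rep (val z)).
have flin : linear f.
  move=> a x y; rewrite /f -clsZ// -clsD ?rpredZ//.
  have inC : a *: rep (val x) + rep (val y) \in submod_add F B.
    by rewrite rpredD ?rpredZ.
  have inA : a *: rep (val x) + rep (val y) \in A.
    by rewrite rpredD ?rpredZ ?rep_in.
  apply/(cls_eqP _ (inFB _) inC)/(cls_eqP B (rep_in _) inA).
  by rewrite repK clsD ?rpredZ ?rep_in// clsZ ?rep_in// !repK linearP.
pose G : {linear submod F' -> subquot (submod_add F B) B} :=
  HB.pack f (GRing.isLinear.Build _ _ _ _ _ flin).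
apply: (length_le_inj hL (f := G)) => x y /(cls_eqP _ (inFB _) (inFB _)) h.
apply: val_inj; rewrite -[LHS]repK -[RHS]repK.
exact/(cls_eqP _ (rep_in _) (rep_in _)).
Qed.

End LengthSums.

(** * The valuation and Gauss's lemma *)

Section Valuation.
Variables (R : idomainType) (K : realType) (v : {fraction R} -> \bar K).
Hypothesis hv : is_nondiscrete_archimedean_valuation v.
Local Notation Q := {fraction R}.
Implicit Types (x y : Q) (p q : {poly Q}).

Lemma tofrac_inj : injective (@tofrac R).
Proof. by move=> x y /eqP; rewrite tofrac_eq => /eqP. Qed.

Lemma map_tofrac_inj : injective (map_poly (@tofrac R)).
Proof. exact: map_inj_poly tofrac_inj (raddf0 _). Qed.

Lemma valuation0 : v 0 = +oo%E.
Proof. exact/(valuation_infty hv). Qed.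

Lemma valuation_fin x : x != 0 -> v x \is a fin_num.
Proof.
move=> /eqP x0; rewrite fin_numE valuation_notNy//=.
by apply/eqP => /(valuation_infty hv).
Qed.

Lemma valuation1 : v 1 = 0%E.
Proof.
have := valuation_fin (oner_neq0 Q); have := valuationM hv 1 1.
rewrite mulr1; case: (v 1) => // r [] /eqP;
  rewrite -subr_eq0 opprD addNKr oppr_eq0.
by move=> /eqP->.
Qed.

Lemma valuationX2 x : v (x * x) = 0%E -> v x = 0%E.
Proof.
rewrite valuationM//; case: (v x) => //= r [] /eqP.
by rewrite -mulr2n mulrn_eq0/= => /eqP->.
Qed.

Lemma valuationN x : v (- x) = v x.
Proof.
by rewrite -mulN1r valuationM// valuationX2 ?add0e// mulrNN mulr1 valuation1.
Qed.

Lemma valuationV x : x != 0 -> v x^-1 = (- v x)%E.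
Proof.
move=> x0; have xV0 : x^-1 != 0 by rewrite invr_eq0.
have := valuationM hv x x^-1; rewrite divff// valuation1.
have := valuation_fin x0; have := valuation_fin xV0.
case: (v x) => // a; case: (v x^-1) => // b _ _ [] e.
by rewrite -EFinN; congr _%:E; apply/eqP; rewrite -addr_eq0 addrC -e.
Qed.

Lemma valuation_ge0 (r : R) : (0 <= v (tofrac r))%E.
Proof. by apply/(valuation_ring hv); exists r. Qed.

Lemma valuation_tofrac_fin (r : R) : r != 0 -> v (tofrac r) \is a fin_num.
Proof. by move=> r0; rewrite valuation_fin// tofrac_eq0. Qed.

Lemma valuation_sum (I : Type) (s : seq I) (F : I -> Q) (c : \bar K) :
  (forall i, (c <= v (F i))%E) -> (c <= v (\sum_(i <- s) F i)%R)%E.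
Proof.
move=> cF; elim/big_rec: _ => [|i x _ cx]; first by rewrite valuation0 leey.
by apply: le_trans (valuationD hv _ _); rewrite le_min cF.
Qed.

Lemma valuation_sum_gt (I : Type) (s : seq I) (P : pred I)
    (F : I -> Q) (c : K) :
  (forall i, P i -> (c%:E < v (F i))%E) ->
    (c%:E < v (\sum_(i <- s | P i) F i)%R)%E.
Proof.
move=> cF; elim/big_rec: _ => [|i x Pi cx]; first by rewrite valuation0 ltry.
by apply: lt_le_trans (valuationD hv _ _); rewrite lt_min cF.
Qed.

Lemma valuationD_lt x y : (v x < v y)%E -> v (x + y) = v x.
Proof.
move=> xy; apply/le_anti/andP; split; last first.
  by apply: le_trans (valuationD hv _ _); rewrite le_min lexx ltW.
have := valuationD hv (x + y) (- y);
  rewrite addrK valuationN ge_min => /orP[]//.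
by move=> yx; have := lt_le_trans xy yx; rewrite ltxx.
Qed.

(** The Gauss valuation of [p] is [a]: the minimum of the values of the
    coefficients, a relation since the zero polynomial has none in [K]. *)
Definition gauss p (a : K) : Prop :=
  (forall i, (a%:E <= v p`_i)%E) /\ exists i, v p`_i = a%:E.

Lemma gauss_exists p : p != 0 -> exists a, gauss p a.
Proof.
move=> p0; have sp : (0 < size p)%N by rewrite size_poly_gt0.
pose i0 : 'I_(size p) := Ordinal sp.
case: (@Order.TotalTheory.arg_minP _ _ _ i0 xpredT (fun i : 'I_(size p) =>
  v p`_i)) => // i _ imin.
have lead : v p`_(size p).-1 \is a fin_num.
  by rewrite valuation_fin// -lead_coefE lead_coef_eq0.
have vi : v p`_i \is a fin_num.
  rewrite fin_numE valuation_notNy//=; apply/eqP => vy.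
  have lt1 : ((size p).-1 < size p)%N by rewrite prednK.
  have := imin (Ordinal lt1) isT; rewrite vy leye_eq /= => /eqP e.
  by move: lead; rewrite e.
exists (fine (v p`_i)); split=> [j|]; last by exists i; rewrite fineK.
rewrite fineK//; case: (ltnP j (size p)) => jp;
  first exact: (imin (Ordinal jp)).
by rewrite [p`_j]nth_default// valuation0 leey.
Qed.

Lemma gauss_first p a : gauss p a ->
  exists2 i, v p`_i = a%:E & forall j, (j < i)%N -> (a%:E < v p`_j)%E.
Proof.
move=> [ap [i0 i0a]].
have ex : exists i, v p`_i == a%:E by exists i0; apply/eqP.
case: (ex_minnP ex) => i /eqP ia imin; exists i => // j ji.
rewrite lt_neqAle ap andbT eq_sym; apply/negP => /imin.
by rewrite leqNgt ji.
Qed.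

(** Gauss's lemma: the product of the first coefficients of minimal value
    strictly dominates every other contribution to its degree. *)
Lemma gaussM p q a b : gauss p a -> gauss q b -> gauss (p * q) (a + b).
Proof.
move=> gp gq; have [[ap _] [bq _]] := (gp, gq); split=> [k|].
  rewrite coefM; apply: valuation_sum => i.
  by rewrite valuationM// EFinD leeD.
have [i ia imin] := gauss_first gp; have [j jb jmin] := gauss_first gq.
exists (i + j)%N; rewrite coefM.
have iij : (i < (i + j).+1)%N by rewrite ltnS leq_addr.
rewrite (bigD1 (Ordinal iij))//= addKn.
have vij : v (p`_i * q`_j) = (a + b)%:E by rewrite valuationM// ia jb.
rewrite valuationD_lt ?vij//; apply: valuation_sum_gt => k ki.
rewrite valuationM// EFinD; case: (ltngtP k i) => [lt_ki|lt_ik|eki].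
- by apply: lte_leD => //; exact: imin.
- apply: lee_ltD => //; apply: jmin.
  have : (k < (i + j).+1)%N by [].
  lia.
- by move: ki; rewrite -val_eqE/= eki eqxx.
Qed.

Lemma gauss_integral p a : gauss p a -> 0 <= a ->
  exists r, p = map_poly (@tofrac R) r.
Proof.
move=> [ap _] a0.
have /choice[c cP] : forall i, exists r : R, p`_i = tofrac r.
  by move=> i; apply/(valuation_ring hv); apply: le_trans (ap i);
    rewrite lee_fin.
exists (\poly_(i < size p) c i); apply/polyP => i.
rewrite coef_map coef_poly; case: ltnP => ip; first by rewrite cP.
by rewrite nth_default// raddf0.
Qed.

Definition primitive (q : {poly R}) := gauss (map_poly (@tofrac R) q) 0.

Lemma primitiveM (q r : {poly R}) : primitive q -> primitive r ->
  primitive (q * r).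
Proof.
by move=> qP rP; rewrite /primitive rmorphM -[0]addr0; exact: gaussM.
Qed.

Lemma primitive_neq0 (q : {poly R}) : primitive q -> q != 0.
Proof.
by move=> [_ [i]]; apply/contra_eq_neq => ->; rewrite rmorph0 coef0 valuation0.
Qed.

(** The cofactor has the Gauss valuation of the multiple, which is nonnegative,
    so its coefficients are already in [R]. *)
Lemma primitive_dvd (q r : {poly R}) : primitive q ->
  map_poly (@tofrac R) q %| map_poly (@tofrac R) r -> exists h, r = q * h.
Proof.
move=> qP /dvdpP[h rE]; have [h0|h0] := eqVneq h 0.
  exists 0; apply: map_tofrac_inj.
  by rewrite rE h0 mul0r mulr0 rmorph0.
have [a ha] := gauss_exists h0; have := gaussM ha qP;
  rewrite -rE addr0 => -[_ [i ri]].
have a0 : 0 <= a by rewrite -lee_fin -ri coef_map valuation_ge0.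
have [g gE] := gauss_integral ha a0; exists g.
by apply: map_tofrac_inj; rewrite rE gE rmorphM mulrC.
Qed.

(** A monic polynomial becomes primitive after dividing by a coefficient of
    least value. *)
Lemma monic_primitive p : p \is monic ->
  exists2 q : {poly R}, primitive q &
    map_poly (@tofrac R) q = tofrac (lead_coef q) *: p.
Proof.
move=> pm; have [a pa] := gauss_exists (monic_neq0 pm).
have [i ia] := pa.2; have pi0 : p`_i != 0.
  by apply: contra_eq_neq ia => ->; rewrite valuation0.
have g1 : gauss ((p`_i)^-1 *: p) 0.
  have vV : v (p`_i)^-1 = (- a%:E)%E by rewrite valuationV// ia.
  split=> [j|]; last by exists i; rewrite coefZ mulVf// valuation1.
  by rewrite coefZ valuationM// vV -EFinN -(subrr a) EFinD addeC leeD2l// pa.1.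
have [q qE] := gauss_integral g1 (lexx 0); exists q;
  first by rewrite /primitive -qE.
rewrite -qE; congr (_ *: _).
have := congr1 lead_coef qE; rewrite lead_coefZ (monicP pm) mulr1 => ->.
by rewrite lead_coef_map_inj ?raddf0//; exact: tofrac_inj.
Qed.

End Valuation.

(** * Polynomials acting on a module *)

Section PolynomialAction.
Variables (F : comNzRingType) (V : lmodType F) (f : {linear V -> V}).
Implicit Types (p q : {poly F}) (x : V).

Definition pact p x := \sum_(i < size p) p`_i *: iter i f x.

Lemma pactE N p x : (size p <= N)%N ->
  pact p x = \sum_(i < N) p`_i *: iter i f x.
Proof.
move=> pN; rewrite /pact (big_ord_widen N (fun i =>
  p`_i *: iter i f x))// big_mkcond.
by apply: eq_bigr => i _; case: ltnP => // pi; rewrite nth_default// scale0r.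
Qed.

Lemma pactD p q x : pact (p + q) x = pact p x + pact q x.
Proof.
rewrite !(@pactE (maxn (size p) (size q))) ?leq_maxl ?leq_maxr ?size_polyD//.
by rewrite -big_split; apply: eq_bigr => i _; rewrite coefD scalerDl.
Qed.

Lemma pactZ a p x : pact (a *: p) x = a *: pact p x.
Proof.
rewrite (@pactE (size p)) ?size_scale_leq// scaler_sumr.
by apply: eq_bigr => i _; rewrite coefZ scalerA.
Qed.

Lemma pactB p q x : pact (p - q) x = pact p x - pact q x.
Proof. by rewrite pactD -(scaleN1r q) pactZ scaleN1r. Qed.

Lemma pact0 x : pact 0 x = 0.
Proof. by rewrite /pact size_poly0 big_ord0. Qed.

Lemma pactXn i x : pact 'X^i x = iter i f x.
Proof.
rewrite (@pactE i.+1) ?size_polyXn// big_ord_recr/= coefXn eqxx scale1r.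
rewrite big1 ?add0r// => j _; rewrite coefXn ltn_eqF// scale0r//.
Qed.

Lemma pactZXn a i x : pact (a *: 'X^i) x = a *: iter i f x.
Proof. by rewrite pactZ pactXn. Qed.

Lemma pactZr p a x : pact p (a *: x) = a *: pact p x.
Proof.
rewrite /pact scaler_sumr; apply: eq_bigr => i _.
by rewrite iter_linearZ !scalerA mulrC.
Qed.

Lemma pactXM p x : pact ('X * p) x = f (pact p x).
Proof.
rewrite mulrC (@pactE (size p).+1).
  rewrite /pact big_ord_recl coefMX eqxx scale0r add0r linear_sum.
  by apply: eq_bigr => i _; rewrite coefMX linearZ.
have [->|p0] := eqVneq p 0; first by rewrite mul0r size_poly0.
by rewrite size_mulX.
Qed.

Lemma pactM p q x : pact (p * q) x = pact p (pact q x).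
Proof.
elim/poly_ind: p => [|p c IH]; first by rewrite mul0r !pact0.
rewrite mulrDl !pactD -(mulrC 'X) -mulrA !pactXM IH; congr (_ + _).
rewrite mul_polyC pactZ -alg_polyC pactZ; congr (_ *: _).
by rewrite -(expr0 'X) pactXn.
Qed.

End PolynomialAction.

(** * Cyclic modules over a valuation ring, and lattices *)
Section ValuationLength.
Variables (K : realType) (R : idomainType) (v : {fraction R} -> \bar K).
Hypothesis hv : is_nondiscrete_archimedean_valuation v.
Variable Lv : lmodType R -> \bar K.
Hypothesis hLv : is_valuation_length v Lv.
Local Notation hL := hLv.1.
Local Notation ell := (ell Lv).

(** The infimum over the annihilator [s R] is attained at its generator. *)
Lemma ell_cyclic_val (M : lmodType R) (A B : submodClosed M) (z : M) (s : R) :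
  z \in A -> (forall x, x \in A -> exists r : R, x - r *: z \in B) ->
  (forall r : R, r *: z \in B <-> exists t, r = s * t) ->
  ell A B = v (tofrac s).
Proof.
move=> zA zgen zann; rewrite (ell_cyclic hL zA zgen) hLv.2.
apply/le_anti/andP; split.
  apply: ereal_inf_lbound; exists s => //=.
  by rewrite mem_ann_mod; apply/zann; exists 1; rewrite mulr1.
apply: le_ereal_inf_tmp => _ [r /= rI <-].
move: rI; rewrite mem_ann_mod => /zann[t ->].
by rewrite rmorphM valuationM// leeDl// valuation_ge0.
Qed.

(** Otherwise the class of [x] generates a copy of [R], whose length is [+oo]
    because the infimum is then taken over the value of [0] only. *)
Lemma ell_torsion (M : lmodType R) (A B : submodClosed M) x :
  (ell A B < +oo)%E -> x \in A -> exists2 r : R, r != 0 & r *: x \in B.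
Proof.
move=> fin xA; apply: contrapT => nr.
pose C := submod_range (orbit_map x : {linear R^o -> M}).
have CA : forall y, y \in C -> y \in A.
  by move=> y /mem_submod_range[r <-]; rewrite rpredZ.
have : (ell C B < +oo)%E by apply: le_lt_trans fin; apply: (ell_mono hL).
rewrite (ell_cyclic hL (z := x)).
- rewrite hLv.2 (_ : ereal_inf _ = +oo%E)//; apply/eqP; rewrite -leye_eq.
  apply: le_ereal_inf_tmp => _ [r /= rI <-].
  have [->|r0] := eqVneq r 0; first by rewrite rmorph0 valuation0.
  by case: nr; exists r; rewrite // -mem_ann_mod.
- by apply/mem_submod_range; exists 1; rewrite /= /orbit_map scale1r.
- by move=> y /mem_submod_range[r <-]; exists r; rewrite subrr rpred0.
Qed.

Lemma ell_orbit_fin (M : lmodType R) (B : submodClosed M) x r :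
  r != 0 -> r *: x \in B ->
  (ell (submod_range (orbit_map x : {linear R^o -> M})) B < +oo)%E.
Proof.
move=> r0 rx; rewrite (ell_cyclic hL (z := x)).
- rewrite hLv.2; apply: le_lt_trans (_ : v (tofrac r) < +oo)%E.
    by apply: ereal_inf_lbound; exists r => //=; rewrite mem_ann_mod.
  by have := valuation_tofrac_fin hv r0; rewrite ge0_fin_numE// valuation_ge0.
- by apply/mem_submod_range; exists 1; rewrite /= /orbit_map scale1r.
- by move=> y /mem_submod_range[t <-]; exists t; rewrite subrr rpred0.
Qed.

End ValuationLength.

Section Lattices.
Variables (R : idomainType) (n : nat).
Local Notation Q := {fraction R}.
Local Notation V := (fracpow R n).
Local Notation "r %:F" := (@tofrac R r).

Lemma fracpowE (a : R) (x : V) : a *: x = a%:F *: (x : 'rV[Q]_n).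
Proof. by []. Qed.

Section RowLattice.
Variables (m : nat) (G : 'M[Q]_(m, n)).

Definition lattice_pred : {pred V} :=
  fun x => `[< exists y : 'rV[R]_m, x = map_mx (@tofrac R) y *m G >].

Fact lattice_closed : subsemimod_closed lattice_pred.
Proof.
split; first split.
- by apply/asboolP; exists 0; rewrite map_mx0 mul0mx.
- move=> _ _ /asboolP[x ->] /asboolP[y ->].
  by apply/asboolP; exists (x + y); rewrite map_mxD mulmxDl.
- move=> a _ /asboolP[x ->]; apply/asboolP; exists (a *: x).
  by rewrite map_mxZ -scalemxAl.
Qed.

HB.instance Definition _ :=
  GRing.isSubmodClosed.Build R V lattice_pred lattice_closed.

Definition lattice : submodClosed V := lattice_pred.

Lemma mem_lattice x :
  x \in lattice <-> exists y : 'rV[R]_m, x = map_mx (@tofrac R) y *m G.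
Proof. by split=> [/asboolP|h]//; apply/asboolP. Qed.

Lemma row_lattice i : (row i G : V) \in lattice.
Proof.
apply/mem_lattice; exists (delta_mx 0 i); rewrite rowE; congr (_ *m _).
by apply/rowP => j; rewrite !mxE rmorph_nat.
Qed.

Lemma lattice_sub (B : submodClosed V) :
  (forall i, (row i G : V) \in B) -> forall x, x \in lattice -> x \in B.
Proof.
move=> GB x /mem_lattice[y ->]; rewrite mulmx_sum_row.
apply: (big_ind (fun z : V => z \in B)); [exact: rpred0|exact: rpredD|].
by move=> i _; rewrite mxE -fracpowE rpredZ.
Qed.

End RowLattice.

End Lattices.

Section Denominators.
Variables (K : realType) (R : idomainType) (v : {fraction R} -> \bar K).
Hypothesis hv : is_nondiscrete_archimedean_valuation v.
Local Notation "r %:F" := (@tofrac R r).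

(** In a valuation ring, one of a fraction and its inverse is integral. *)
Lemma frac_denominator (x : {fraction R}) :
  exists ab : R * R, ab.2 != 0 /\ ab.2%:F * x = ab.1%:F.
Proof.
have [x0|x0] := leP 0%E (v x).
  have [r ->] := (valuation_ring hv x).1 x0.
  by exists (r, 1); rewrite oner_neq0 rmorph1 mul1r.
have xn0 : x != 0 by apply: contraTneq x0 => ->;
  rewrite (valuation0 hv) ltNge leey.
have /(valuation_ring hv)[b xb] : (0 <= v (x^-1)%R)%E.
  by rewrite valuationV// oppe_ge0 ltW.
exists (1, b); rewrite /= -tofrac_eq0 -xb invr_eq0 xn0; split=> //=.
by rewrite mulVf// rmorph1.
Qed.

Lemma common_denominator m k (G : 'M[{fraction R}]_(m, k)) :
  exists2 d : R, d != 0 &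
    exists G' : 'M[R]_(m, k), d%:F *: G = map_mx (@tofrac R) G'.
Proof.
have /choice[g gP] : forall ij : 'I_m * 'I_k, exists ab : R * R,
    ab.2 != 0 /\ ab.2%:F * G ij.1 ij.2 = ab.1%:F.
  by move=> ij; exact: frac_denominator.
exists (\prod_ij (g ij).2).
  by apply/prodf_neq0 => ij _; case: (gP ij).
exists (\matrix_(i, j) ((\prod_(ij | ij != (i, j)) (g ij).2) * (g (i, j)).1)).
apply/matrixP => i j; rewrite !mxE (bigD1 (i, j))//= !rmorphM/=.
by have /= [_ <-] := gP (i, j); rewrite mulrCA mulrA.
Qed.

End Denominators.

(** * Adjoining a cyclic quotient to a lattice *)

Lemma traj_pact (R : comNzRingType) (M : lmodType R) (phi : {linear M -> M})
    (H : submodClosed M) k (p : {poly R}) x : (size p <= k)%N -> x \in H ->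
  pact phi p x \in partial_trajectory phi H k.
Proof.
move=> pk xH; apply: rpred_sum => i _; apply: rpredZ; apply: traj_iter => //.
exact: leq_trans pk.
Qed.

(** [E0] is a lattice in the invariant subspace [W], the class of [y] modulo
    [W] has the primitive polynomial [q], of degree [d + 1], as annihilator, and
    [E] is [E0 + sum_(j <= d) R phi^j y]. *)
Section CyclicExtension.
Variables (K : realType) (R : idomainType) (v : {fraction R} -> \bar K).
Hypothesis hv : is_nondiscrete_archimedean_valuation v.
Variable Lv : lmodType R -> \bar K.
Hypothesis hLv : is_valuation_length v Lv.
Local Notation hL := hLv.1.
Local Notation ell := (ell Lv).
Variable n : nat.
Local Notation Q := {fraction R}.
Local Notation V := (fracpow R n).
Local Notation "r %:F" := (@tofrac R r).
Variable phi : {linear 'rV[Q]_n -> 'rV[Q]_n}.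
Local Notation psi := (restrict_scalars phi).
Local Notation T := (partial_trajectory psi).

Lemma pact_restrict (r : {poly R}) (x : V) :
  pact psi r x = pact phi (map_poly (@tofrac R) r) x.
Proof.
rewrite (@pactE _ _ phi (size r)); last first.
  by rewrite (size_map_inj_poly (@tofrac_inj R) (raddf0 _)).
by apply: eq_bigr => i _; rewrite coef_map.
Qed.

Variables (E0 E : submodClosed V) (W : pred 'rV[Q]_n) (y : V).
Variables (q : {poly R}) (d : nat).
Hypothesis qP : primitive v q.
Hypothesis size_q : size q = d.+2.
Hypothesis WD : forall x z, W x -> W z -> W (x - z).
Hypothesis TW : forall k x, x \in T E0 k -> W x.
Hypothesis Wy : forall g : {poly Q},
  W (pact phi g y) -> map_poly (@tofrac R) q %| g.
Hypothesis qy : pact psi q y \in E0.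
Hypothesis mem_E : forall x, x \in E <->
  exists w (r : {poly R}),
    [/\ w \in E0, (size r <= d.+1)%N & x = w + pact psi r y].

Let E0_sub_E x : x \in E0 -> x \in E.
Proof.
by move=> xE; apply/mem_E; exists x, 0; rewrite size_poly0 pact0 addr0.
Qed.

Lemma pact_in_dvd (r : {poly R}) : W (pact psi r y) -> exists h, r = q * h.
Proof. by rewrite pact_restrict => /Wy; exact: primitive_dvd hv _ _ qP. Qed.

Lemma mem_traj_ext k x : x \in T E k.+1 <->
  exists w (r : {poly R}),
    [/\ w \in T E0 k.+1, (size r <= k + d.+1)%N & x = w + pact psi r y].
Proof.
elim: k x => [|k IH] x.
  rewrite traj1 mem_E add0n; split=> -[w [r [wE rd ->]]]; exists w, r;
    split=> //.
    exact/traj1.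
  exact/(traj1 psi).
split=> [/traj_recr[_ [_ [/IH[w [r [wE rd ->]]] /mem_E[w' [r' [wE' rd' ->]]]
  ->]]]|].
  exists (w + iter k.+1 psi w'), (r + 'X^(k.+1) * r'); split.
  - by apply/traj_recr; exists w, w'.
  - apply: leq_trans (size_polyD _ _) _; rewrite geq_max; apply/andP; split.
      by apply: leq_trans rd _; rewrite leq_add2r.
    apply: leq_trans (size_polyMleq _ _) _; rewrite size_polyXn.
    by rewrite addSn /= leq_add2l.
  - by rewrite pactD pactM pactXn iter_linear addrACA.
move=> [_ [r [/traj_recr[w [w' [wE wE' ->]]] rd ->]]].
apply/traj_recr; exists (w + pact psi (take_poly (k + d.+1) r) y).
exists (w' + r`_(k + d.+1) *: iter d psi y); split.
- by apply/IH; exists w, (take_poly (k + d.+1) r); rewrite size_take_poly.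
- apply/mem_E; exists w', (r`_(k + d.+1) *: 'X^d); split=> //.
    by rewrite (leq_trans (size_scale_leq _ _))// size_polyXn.
  by rewrite pactZXn.
rewrite iter_linear iter_linearZ -iterD addrACA; congr (_ + _).
rewrite addSnnS -pactZXn -pactD; congr (pact _ _ _).
apply/polyP => i; rewrite coefD coef_take_poly coefZ coefXn.
case: ltngtP => ik.
- by rewrite mulr0 addr0.
- by rewrite nth_default ?mulr0 ?addr0//; apply: leq_trans rd _; lia.
- by rewrite ik mulr1 add0r.
Qed.

(** If [w + r(phi) y] is in [W], with [w] in [T_k E0], then [r = q h] in
    [R[X]] by Gauss's lemma.  As [q(phi) y] is in [E0], [y] contributes to [W]
    only [h(phi)] of an element of [E0], and [h] has lost the [d + 1] degrees
    that the iterates of [y] have in advance. *)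
Lemma traj_ext_cap k x : x \in T E0 k.+2 ->
  x \in T E k.+1 <-> x \in T E0 k.+1.
Proof.
move=> xE0; split=> [|]; last exact: traj_sub E0_sub_E.
move=> /mem_traj_ext[w [r [wE rd e]]].
have /pact_in_dvd[h rE] : W (pact psi r y).
  rewrite -[pact _ _ _](addKr w) addrC -e.
  by apply: WD; [apply: (TW (k := k.+2))|apply: (TW (k := k.+1))].
rewrite e rpredD// rE mulrC pactM; apply: traj_pact => //.
have [->|h0] := eqVneq h 0; first by rewrite size_poly0.
have q0 : q != 0 by rewrite -size_poly_eq0 size_q.
by move: rd; rewrite rE size_mul// size_q addSn /= addnC leq_add2r => /leqW.
Qed.

(** Insert [T_(k+1) E0 + T_k E] between [T_k E] and [T_(k+1) E].  The lower
    layer is the growth of [E0], by [traj_ext_cap].  The upper layer is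
    generated by the single new power [phi^N y]; its annihilator consists of
    the leading coefficients of the multiples of [q] of degree [N], that is, of
    [lead_coef q * R]. *)
Lemma ell_traj_ext k :
  ell (T E k.+2) (T E k.+1) =
  (ell (T E0 k.+2) (T E0 k.+1) + v (lead_coef q)%:F)%E.
Proof.
pose C := submod_add (T E0 k.+2) (T E k.+1).
pose N := (k + d.+1)%N.
have lq : lead_coef q = q`_d.+1 by rewrite lead_coefE size_q.
rewrite (ell_chain hL (B := C)); first last.
- by move=> x; exact: submod_addr.
- move=> x /mem_submod_add[a [b [aE bE ->]]]; apply: rpredD.
    exact: traj_sub E0_sub_E aE.
  exact: traj_mono1.
congr (_ + _)%E.
  rewrite (ell_addr hL); apply: (eq_ell hL) => // x xE.
  by apply: iff_sym; exact: traj_ext_cap.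
have memC w (r : {poly R}) : w \in T E0 k.+2 -> (size r <= N)%N ->
  w + pact psi r y \in C.
  move=> wE rN; apply/mem_submod_add; exists w, (pact psi r y); split=> //.
  by apply/mem_traj_ext; exists 0, r; rewrite rpred0 add0r.
apply: (ell_cyclic_val hv hLv (z := iter N psi y)).
- apply/mem_traj_ext; exists 0, 'X^N.
  by rewrite rpred0 size_polyXn add0r pactXn.
- move=> x /mem_traj_ext[w [r [wE rN ->]]]; exists r`_N.
  rewrite -addrA -pactZXn -pactB; apply: memC => //.
  apply/leq_sizeP => j; rewrite leq_eqVlt => /predU1P[<-|Nj].
    by rewrite coefB coefZ coefXn eqxx mulr1 subrr.
  rewrite coefB coefZ coefXn gtn_eqF// mulr0 subr0 nth_default//.
  by apply: leq_trans rN _.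
move=> c; split=> [|[t ->]].
  move=> /mem_submod_add[w [_ [wE /mem_traj_ext[w' [r [wE' rN ->]]] e]]].
  have /pact_in_dvd[h rE] : W (pact psi (c *: 'X^N - r) y).
    rewrite pactB pactZXn e addrA addrK -[w']opprK; apply: WD.
      exact: TW wE.
    rewrite -[- w']scaleN1r; apply: (TW (k := k.+1)).
    by rewrite -[-1 *: _]/((-1 : R) *: (w' : V)) rpredZ.
  have [->|c0] := eqVneq c 0; first by exists 0; rewrite mulr0.
  exists (lead_coef h); rewrite -lead_coefM -rE lead_coefDl.
    by rewrite lead_coefZ lead_coefXn mulr1.
  by rewrite size_polyN size_scale// size_polyXn ltnS.
have -> : (lead_coef q * t) *: iter N psi y =
    iter k psi (t *: pact psi q y) +
    pact psi ((lead_coef q * t) *: 'X^N - t *: ('X^k * q)) y.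
  by rewrite pactB pactZXn [pact psi (t *: _) y]pactZ pactM pactXn iter_linearZ
    addrC subrK.
apply: memC.
  by apply: traj_iter; [exact: ltnW|exact: rpredZ].
apply/leq_sizeP => j Nj; rewrite coefB !coefZ coefXn coefXnM.
rewrite ltnNge (leq_trans (leq_addr _ _) Nj)/= lq.
move: Nj; rewrite leq_eqVlt => /predU1P[<-|Nj].
  by rewrite eqxx mulr1 addKn mulrC subrr.
rewrite gtn_eqF// mulr0 [q`__]nth_default ?mulr0 ?subr0// size_q.
by rewrite /N in Nj; lia.
Qed.

End CyclicExtension.

(** * Lattices adapted to an endomorphism *)

Lemma char_poly_lblock (F : comNzRingType) m1 m2 (A : 'M[F]_m1)
    (D : 'M[F]_(m2, m1)) (B : 'M[F]_m2) :
  char_poly (block_mx A 0 D B) = char_poly A * char_poly B.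
Proof.
rewrite /char_poly -(det_lblock _ (- map_mx polyC D)); congr (\det _).
by rewrite /char_poly_mx map_block_mx/= map_mx0 scalar_mx_block opp_block_mx
  add_block_mx !add0r oppr0.
Qed.

Lemma char_poly_similar (F : fieldType) m (P A B : 'M[F]_m) :
  P \in unitmx -> P *m A = B *m P -> char_poly A = char_poly B.
Proof.
move=> Pu PA; pose P' := map_mx polyC P.
have detP : \det P' != 0.
  by rewrite det_map_mx polyC_eq0 -unitfE -unitmxE.
have e : P' *m char_poly_mx A = char_poly_mx B *m P'.
  by rewrite /char_poly_mx mulmxBr mulmxBl -!map_mxM PA scalar_mxC.
apply: (mulfI detP); rewrite /char_poly -det_mulmx e det_mulmx.
by rewrite mulrC.
Qed.

Section Krylov.
Variables (F : fieldType) (n : nat) (phi : {linear 'rV[F]_n -> 'rV[F]_n}).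

Definition krylov k (x : 'rV[F]_n) : 'M[F]_(k, n) :=
  \matrix_(i < k) iter i phi x.

Lemma mul_krylov k (u : 'rV[F]_k) x : u *m krylov k x = pact phi (rVpoly u) x.
Proof.
rewrite mulmx_sum_row (@pactE _ _ phi k) ?size_poly//.
by apply: eq_bigr => i _; rewrite coef_rVpoly_ord rowK.
Qed.

Lemma krylov_pact k (p : {poly F}) x : (size p <= k)%N ->
  pact phi p x = poly_rV p *m krylov k x.
Proof. by move=> pk; rewrite mul_krylov poly_rV_K. Qed.

(** [n + 1] iterates in a space of dimension [n] are dependent. *)
Lemma pact_kernel x : exists2 g : {poly F}, g != 0 & pact phi g x = 0.
Proof.
have /rowV0Pn[u /sub_kermxP uK u0] : kermx (krylov n.+1 x) != 0.
  by rewrite kermx_eq0 /row_free ltn_eqF// ltnS rank_leq_col.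
exists (rVpoly u); last by rewrite -mul_krylov.
by apply: contra_neq u0 => /(congr1 (@poly_rV _ n.+1)); rewrite rVpolyK linear0.
Qed.

(** The annihilator of the class of [x] modulo a subspace is a principal ideal,
    generated by a nonzero element of least degree. *)
Lemma conductor m (B : 'M[F]_(m, n)) x :
  (forall z, (z <= B)%MS -> (phi z <= B)%MS) ->
  exists2 f : {poly F}, f \is monic &
    (pact phi f x <= B)%MS /\ forall g, (pact phi g x <= B)%MS -> f %| g.
Proof.
move=> Bphi.
have Bact g z : (z <= B)%MS -> (pact phi g z <= B)%MS.
  move=> zB; apply: summx_sub => i _; apply: scalemx_sub.
  by elim: (nat_of_ord i) => //= j; exact: Bphi.
have ex : exists k, `[< exists g : {poly F}, [/\ g != 0,
  (pact phi g x <= B)%MS & size g = k] >].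
  have [g g0 gx] := pact_kernel x; exists (size g); apply/asboolP; exists g.
  by rewrite g0 gx sub0mx.
case: (ex_minnP ex) => k /asboolP[g [g0 gx gk]] kmin.
have lg : lead_coef g != 0 by rewrite lead_coef_eq0.
exists ((lead_coef g)^-1 *: g); first by rewrite monicE lead_coefZ mulVf.
split=> [|h hx]; first by rewrite pactZ scalemx_sub.
rewrite dvdpZl ?invr_eq0//; apply: contraT => ndiv.
have /kmin : `[< exists g' : {poly F}, [/\ g' != 0,
  (pact phi g' x <= B)%MS & size g' = size (h %% g)] >].
  apply/asboolP; exists (h %% g); split=> //.
  have -> : h %% g = h - h %/ g * g by rewrite {2}(divp_eq h g) addrC addKr.
  by rewrite pactB pactM addmx_sub// eqmx_opp Bact.
by rewrite -gk leqNgt ltn_modp g0.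
Qed.

End Krylov.

Section AdaptedLattice.
Variables (K : realType) (R : idomainType) (v : {fraction R} -> \bar K).
Hypothesis hv : is_nondiscrete_archimedean_valuation v.
Variable Lv : lmodType R -> \bar K.
Hypothesis hLv : is_valuation_length v Lv.
Local Notation hL := hLv.1.
Local Notation ell := (ell Lv).
Variable n : nat.
Local Notation Q := {fraction R}.
Local Notation V := (fracpow R n).
Local Notation "r %:F" := (@tofrac R r).
Variable phi : {linear 'rV[Q]_n -> 'rV[Q]_n}.
Local Notation psi := (restrict_scalars phi).
Local Notation T := (partial_trajectory psi).
Local Notation A := (lin1_mx phi).

(** The rows of [B] span an invariant subspace, on which [C] is the matrix of
    [phi] and [q] the primitive multiple of the characteristic polynomial. *)
Record adapted m (B : 'M[Q]_(m, n)) (C : 'M[Q]_m) (q : {poly R}) : Prop := {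
  adapted_free : row_free B;
  adapted_stable : B *m A = C *m B;
  adapted_primitive : primitive v q;
  adapted_charpoly : map_poly (@tofrac R) q = (lead_coef q)%:F *: char_poly C;
  adapted_length : forall k,
    ell (T (lattice B) k.+2) (T (lattice B) k.+1) = v (lead_coef q)%:F
}.

Lemma adapted0 : adapted (0 : 'M_(0, n)) 0 1.
Proof.
split.
- by rewrite /row_free mxrank0.
- by rewrite !mul0mx.
- rewrite /primitive rmorph1; split=> [i|]; last first.
    by exists 0; rewrite coef1 eqxx valuation1.
  by rewrite coef1; case: i => [|i];
    rewrite ?(valuation1 hv) ?(valuation0 hv) ?leey.
- by rewrite rmorph1 lead_coef1 rmorph1 /char_poly det_mx00 scale1r.
- move=> k; rewrite lead_coef1 rmorph1 (valuation1 hv);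
  apply: (ell_sub0 hL) => x.
  move=> /mem_traj[h hB ->]; apply: rpred_sum => i _.
  have /mem_lattice[u ->] := hB i; rewrite mulmx0.
  by rewrite (iter_linear0 psi) rpred0.
Qed.

(** Take [x] outside the row space of [B] and its conductor [f].  With [p]
    the primitive multiple of [f], a multiple [y] of [x] clears the denominators
    of [p(phi) y] in the basis [B].
      Below [B], the rows [phi^j y] make the matrix of [phi] block triangular,
        with the
    companion matrix of [f] as new diagonal block. *)
Lemma adapted_extend m (B : 'M[Q]_(m, n)) C q : adapted B C q -> (m < n)%N ->
  exists m' (B' : 'M[Q]_(m', n)) C' q', (m < m')%N /\ adapted B' C' q'.
Proof.
case=> Bfree BA qP qC Blen mn.
have Bphi z : (z <= B)%MS -> (phi z <= B)%MS.
  by move=> /submxP[u ->]; rewrite -mul_rV_lin1 -mulmxA BA mulmxA submxMl.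
have [x xB] : exists x : 'rV[Q]_n, ~~ (x <= B)%MS.
  have /row_subPn[i iB] : ~~ (1%:M <= B)%MS.
    apply: contraL mn => /mxrankS; rewrite mxrank1 (eqP Bfree).
    by rewrite -leqNgt.
  by exists (row i 1%:M).
have [f fm [fx fmin]] := conductor x Bphi.
have [d sf] : exists d, size f = d.+2.
  case sf : (size f) => [|[|d]]; last by exists d.
    by move: sf (monic_neq0 fm) => /eqP; rewrite size_poly_eq0 => ->.
  have f0 : f`_0 = 1 by have := monicP fm; rewrite lead_coefE sf.
  by move: fx; rewrite (@pactE _ _ phi 1) ?sf// big_ord1 f0 scale1r (negPf xB).
have [p pP pf] := monic_primitive hv fm.
have lp : (lead_coef p)%:F != 0.
  by rewrite tofrac_eq0 lead_coef_eq0 (primitive_neq0 hv pP).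
have /submxP[z0 z0E] := fx.
have [c c0 [z cz]] := common_denominator hv ((lead_coef p)%:F *: z0).
have cF : c%:F != 0 by rewrite tofrac_eq0.
pose y : 'rV[Q]_n := c%:F *: x.
have py : pact psi p (y : V) = map_mx (@tofrac R) z *m B.
  have fy : pact phi f y = c%:F *: (z0 *m B) by rewrite -z0E -pactZr.
  by rewrite pact_restrict pf pactZ fy -cz -!scalemxAl !scalerA mulrC.
have ymin g : (pact phi g y <= B)%MS -> map_poly (@tofrac R) p %| g.
  rewrite pf dvdpZl// => gy; apply: fmin; move: gy.
  by rewrite pactZr eqmx_scale.
have size_p : size p = d.+2.
  rewrite -sf -(size_scale f lp) -pf.
  by rewrite (size_map_inj_poly (@tofrac_inj R) (raddf0 _)).
pose X := krylov phi (size f).-1 y.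
have sf1 : (size f).-1 = d.+1 by rewrite sf.
pose B' := col_mx B X.
have mem_B' (w : V) : w \in lattice B' <-> exists w0 (r : {poly R}),
    [/\ w0 \in lattice B, (size r <= d.+1)%N & w = w0 + pact psi r (y : V)].
  rewrite mem_lattice; split=> [[u ->]|[_ [r [/mem_lattice[u ->] rd ->]]]].
    exists (map_mx (@tofrac R) (lsubmx u) *m B), (rVpoly (rsubmx u)); split.
    - by apply/mem_lattice; exists (lsubmx u).
    - by rewrite -sf1 size_poly.
    rewrite -{1}[u]hsubmxK map_row_mx mul_row_col pact_restrict; congr (_ + _).
    rewrite mul_krylov; congr (pact phi _ y); apply/polyP => i.
    rewrite coef_map !coef_rVpoly; case: insubP => [j _ _|_];
      last by rewrite raddf0.
    by rewrite mxE.
  exists (row_mx u (poly_rV r)); rewrite map_row_mx mul_row_col pact_restrict.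
  congr (_ + _); rewrite (@krylov_pact _ _ phi (size f).-1).
    congr (_ *m _); apply/rowP => i; rewrite !mxE coef_map//.
  by rewrite sf1 (size_map_inj_poly (@tofrac_inj R) (raddf0 _)).
pose D : 'M[Q]_((size f).-1, m) :=
  \matrix_(i < (size f).-1) if i == (size f).-2 :> nat then c%:F *: z0 else 0.
exists (m + (size f).-1)%N, B', (block_mx C 0 D (companionmx f)), (q * p).
split; first by rewrite sf1 -addSnnS leq_addr.
split.
- rewrite -kermx_eq0; apply/rowV0P => u /sub_kermxP.
  rewrite -[u]hsubmxK mul_row_col mul_krylov => /eqP.
  rewrite addrC addr_eq0 => /eqP uE.
  have ur : rVpoly (rsubmx u) = 0.
    apply/eqP; apply: contraTT isT => r0.
    have : map_poly (@tofrac R) p %| rVpoly (rsubmx u).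
      by apply: ymin; rewrite uE eqmx_opp submxMl.
    move=> /(dvdp_leq r0); rewrite (size_map_inj_poly (@tofrac_inj R) (raddf0
      _)) size_p.
    by rewrite leqNgt ltnS -sf1 size_poly.
  have r0 : rsubmx u = 0.
    by rewrite -[LHS](@rVpolyK _ _) ur linear0.
  move: uE; rewrite ur pact0 => /eqP; rewrite eq_sym oppr_eq0 => /eqP uB.
  have l0 : lsubmx u = 0.
    by apply: (row_free_inj Bfree); rewrite uB mul0mx.
  by rewrite l0 r0 row_mx0.
- rewrite mul_col_mx mul_block_col BA mul0mx addr0; congr col_mx.
  apply/row_matrixP => i; rewrite linearD/= !row_mul rowK mul_rV_lin1.
  have [iE|iE] := eqVneq (i : nat) (size f).-2.
    have -> : row i D = c%:F *: z0 by apply/rowP => j; rewrite !mxE iE eqxx mxE.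
    have -> : row i (companionmx f) = - poly_rV f.
      by apply/rowP => j; rewrite !mxE iE eqxx.
    rewrite -scalemxAl -z0E -(@pactZr _ _ phi) mulNmx mul_krylov.
    have -> : rVpoly (poly_rV f : 'rV_(size f).-1) = f - 'X^((size f).-1).
      apply/polyP => j; rewrite coef_rVpoly coefB coefXn.
      case: insubP => [k kj <-|]; first by rewrite mxE /= (ltn_eqF (ltn_ord k))
        subr0.
      rewrite -leqNgt leq_eqVlt => /predU1P[<-|fj].
        by rewrite eqxx -lead_coefE (monicP fm) subrr.
      rewrite gtn_eqF// mulr0n subr0 nth_default//; by move: fj; rewrite sf1 sf.
    by rewrite pactB pactXn opprB addrC subrK iE sf.
  have iS : (i.+1 < (size f).-1)%N.
    by move/eqP: iE; have := ltn_ord i; lia.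
  have -> : row i D = 0 by apply/rowP => j; rewrite !mxE (negPf iE) mxE.
  by rewrite mul0mx add0r rowE (mulmx_delta_companion iS) -rowE rowK.
- exact: (primitiveM hv).
- rewrite rmorphM /= qC pf char_poly_lblock companionmxK// lead_coefM rmorphM.
  by rewrite -scalerAl -scalerAr scalerA.
- move=> k; rewrite (@ell_traj_ext K R v hv Lv hLv n phi (lattice B) (lattice
  B')
    (fun w => (w <= B)%MS) y p d)//.
  + by rewrite Blen lead_coefM rmorphM (valuationM hv).
  + by move=> a b aB bB; rewrite addmx_sub ?eqmx_opp.
  + move=> j w /mem_traj[h hB ->]; apply: summx_sub => i _.
    have hiB : ((h i : 'rV[Q]_n) <= B)%MS.
      by have /mem_lattice[u ->] := hB i; exact: submxMl.
    by elim: (nat_of_ord i) (h i) hiB => //= l IH u /IH; exact: Bphi.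
  + by rewrite py; apply/mem_lattice; exists z.
Qed.

End AdaptedLattice.

(** * Trajectories of inert submodules *)

Section Trajectories.
Variables (R : pzRingType) (K : realType) (L : lmodType R -> \bar K).
Hypothesis hL : is_length_function L.
Variables (M : lmodType R) (phi : {linear M -> M}).
Local Notation ell := (ell L).
Local Notation T := (partial_trajectory phi).
Implicit Types (H F : submodClosed M).

Lemma traj_map H k x : x \in T H k -> phi x \in T H k.+1.
Proof. by move=> xT; apply/traj_recl; exists x, 0; rewrite rpred0 add0r. Qed.

(** [phi] maps [T_(k+2) / T_(k+1)] onto [T_(k+3) / T_(k+2)]. *)
Lemma ell_traj_step H k :
  (ell (T H k.+3) (T H k.+2) <= ell (T H k.+2) (T H k.+1))%E.
Proof.
apply: (ell_le_surj hL (f := phi)) => [x|x _|y]; try exact: traj_map.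
move=> /traj_recl[t [h [tT hH ->]]]; exists t => //.
by rewrite addrK; exact: traj_base.
Qed.

Lemma ell_trajS H k :
  ell (T H k.+2) H = (ell (T H k.+1) H + ell (T H k.+2) (T H k.+1))%E.
Proof. by apply: (ell_chain hL) => x; [exact: traj_mono1|exact: traj_base]. Qed.

Lemma inertE H : inert L phi H <-> (ell (T H 2) H < +oo)%E.
Proof.
rewrite /inert -/(ell _ _) (eq_ell hL (A' := T H 2) (B' := H))// => x.
split=> [/mem_submod_add[h [_ [hH /mem_submod_im[t tH ->] ->]]]|].
  by apply/traj_recl; exists t, h; split=> //; exact/traj1.
move=> /traj_recl[t [h [/traj1 tH hH ->]]]; apply/mem_submod_add.
by exists h, (phi t); split=> //; apply/mem_submod_im; exists t.
Qed.

Lemma inert_step_fin H k : inert L phi H -> (ell (T H k.+2) (T H k.+1) < +oo)%E.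
Proof.
move=> /inertE fin; elim: k => [|k IH];
  last exact: le_lt_trans (ell_traj_step _ _) IH.
rewrite (eq_ell hL (A' := T H 2) (B' := H))// => x _.
by split=> /traj1.
Qed.

Lemma inert_traj_fin H k : inert L phi H -> (ell (T H k.+1) H < +oo)%E.
Proof.
move=> iH; elim: k => [|k IH].
  by rewrite (ell_sub0 hL)// => x /traj1.
by rewrite ell_trajS lte_add_pinfty// inert_step_fin.
Qed.

(** Put [S_k = H + T_k F].  Between [T_(k+1) H = H + phi (T_k H)] and [S_(k+1)]
    lies [H + phi S_k]: the upper layer is an image of [T_k H / S_k], the lower
    one an image of [(H + phi H) / (H + phi F)], which costs at most [e]. *)
Lemma ell_traj_core H F (e : \bar K) : (forall x, x \in F -> x \in H) ->
  (0 <= e)%E ->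
  (ell (T H 2) (submod_add (submod_im phi F) H) <= e)%E ->
  forall k, (ell (T H k.+1) (submod_add (T F k.+1) H) <= k%:R%:E * e)%E.
Proof.
move=> FH e0 He; elim=> [|k IH].
  by rewrite mul0e (ell_sub0 hL)// => x /traj1 xH; exact: submod_addr.
pose S j := submod_add (T F j) H;
  pose mid := submod_add (submod_im phi (S k.+1)) H.
have SH x : x \in S k.+1 -> x \in T H k.+1.
  move=> /mem_submod_add[t [h [tF hH ->]]].
  by apply: rpredD; [exact: traj_sub tF|exact: traj_base].
rewrite (ell_chain hL (B := mid)); first last.
- move=> x /mem_submod_add[_ [h [/traj_recl[t [f [tF fF ->]]] hH ->]]].
  apply/mem_submod_add; exists (phi t), (f + h); split.
  + by apply/mem_submod_im; exists t => //; exact: submod_addl.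
  + by apply: rpredD => //; exact: FH.
  + by rewrite addrA (addrC f).
- move=> x /mem_submod_add[_ [h [/mem_submod_im[s sS ->] hH ->]]].
  by apply/traj_recl; exists s, h; rewrite addrC; split=> //; exact: SH.
rewrite -natr1 EFinD ge0_muleDl ?lee_fin// mul1e addeC; apply: leeD.
  apply: le_trans IH; apply: (ell_le_surj hL (f := phi)) => [x|x _ xS|y].
  + exact: traj_map.
  + by apply: submod_addl; apply/mem_submod_im; exists x.
  + move=> /traj_recl[t [h [tT hH ->]]]; exists t => //.
    by rewrite addrK; exact: submod_addr.
apply: le_trans He; apply: (@ell_le_surj _ _ _ hL _ _ idfun) => [x|x _|y] /=.
- move=> /traj_recl[t [h [/traj1 tH hH ->]]]; rewrite addrC.
  apply/mem_submod_add; exists (phi t), h; split=> //.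
  by apply/mem_submod_im; exists t => //; exact: submod_addr.
- move=> /mem_submod_add[_ [h [/mem_submod_im[f fF ->] hH ->]]].
  apply/mem_submod_add; exists (phi f), h; split=> //.
  by apply: traj_map; exact: traj_base.
- move=> /mem_submod_add[_ [h [/mem_submod_im[_ /mem_submod_add[t [g [tF gH
  ->]]] ->] hH ->]]].
  exists (h + phi g); first by apply/traj_recl; exists g, h; split=> //;
    exact/traj1.
  rewrite linearD (addrC h) -(addrA (phi t)) addrK.
  by apply: submod_addl; exact: traj_map.
Qed.

End Trajectories.

Section UpperBound.
Variables (K : realType) (R : idomainType) (v : {fraction R} -> \bar K).
Hypothesis hv : is_nondiscrete_archimedean_valuation v.
Variable Lv : lmodType R -> \bar K.
Hypothesis hLv : is_valuation_length v Lv.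
Local Notation hL := hLv.1.
Local Notation ell := (ell Lv).
Variable n : nat.
Local Notation Q := {fraction R}.
Local Notation V := (fracpow R n).
Local Notation "r %:F" := (@tofrac R r).

Lemma ell_lattice_fin m (G : 'M[Q]_(m, n)) (B : submodClosed V) :
  (forall i, exists2 r : R, r != 0 & r *: (row i G : V) \in B) ->
  (ell (lattice G) B < +oo)%E.
Proof.
move=> GB.
pose A i : submodClosed V := if insub i is Some j
  then submod_range (orbit_map (row j G : V) : {linear R^o ->
    V}) else submod0 V.
apply: (@le_lt_trans _ _ (ell (\big[@submod_add R V/submod0 V]_(i < m) A i) B)).
  apply: (ell_mono hL) => //; apply: lattice_sub => i.
  apply/(mem_submod_sum A); exists (fun j : nat =>
    if j == i :> nat then (row i G : V) else 0).
    move=> j; case: eqP => [->|_]; last by rewrite rpred0.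
    by rewrite /A valK; apply/mem_submod_range; exists 1;
      rewrite /= /orbit_map scale1r.
  rewrite (bigD1 i)//= eqxx big1 ?addr0// => j ji.
  by rewrite ifN.
apply: le_lt_trans (ell_submod_sum hL _ _ _) _.
apply: lte_sum_pinfty => i _; rewrite /A valK.
by have [r r0 rB] := GB i; exact: (ell_orbit_fin hv hLv r0 rB).
Qed.

(** Rows chosen in [H] with the greatest possible rank already span [H]
    over [Q], since any vector outside their span would raise the rank. *)
Lemma rank_attained (H : submodClosed V) : exists r (G : 'M[Q]_(r, n)),
  (forall i, (row i G : V) \in H) /\ forall x : V,
    x \in H -> ((x : 'rV[Q]_n) <= G)%MS.
Proof.
pose P k := `[< exists r (G : 'M[Q]_(r, n)),
  (forall i, (row i G : V) \in H) /\ \rank G = k >].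
have exP : exists k, P k.
  by exists 0%N; apply/asboolP; exists 0%N, 0; split=> [[]|]//; rewrite mxrank0.
have ubP k : P k -> (k <= n)%N.
  by move=> /asboolP[r [G [_ <-]]]; exact: rank_leq_col.
case: (ex_maxnP exP ubP) => k /asboolP[r [G [GH Gk]]] kmax.
exists r, G; split=> // x xH; apply: contraT => xG.
have : P (\rank (col_mx G (x : 'rV[Q]_n))).
  apply/asboolP; exists (r + 1)%N, (col_mx G (x : 'rV[Q]_n)); split=> // i.
  case: (split_ordP i) => j ->; rewrite ?rowKu ?rowKd//.
  by rewrite (ord1 j) row_id.
move/kmax; rewrite leqNgt => /negP[]; rewrite -Gk.
have : (G < col_mx G (x : 'rV[Q]_n))%MS.
  by rewrite ltmxE -{1}addsmxE addsmxSl col_mx_sub submx_refl (negPf xG).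
exact: rank_ltmx.
Qed.

End UpperBound.

(** * Growth of the adapted lattice and the upper bound *)

Lemma le_of_cofactor (K : realType) (a b c : \bar K) : a != -oo%E ->
  (b + c = 0 -> 0 <= a + c -> b <= a)%E.
Proof.
case: a => [a| |]//; case: b => [b| |]//; case: c => [c| |]// _;
  rewrite ?leey//.
by move=> [] /eqP; rewrite addr_eq0 => /eqP->;
  rewrite !lee_fin -[- c]add0r lerBlDr.
Qed.

Section Entropy.
Variables (K : realType) (R : idomainType) (v : {fraction R} -> \bar K).
Hypothesis hv : is_nondiscrete_archimedean_valuation v.
Variable Lv : lmodType R -> \bar K.
Hypothesis hLv : is_valuation_length v Lv.
Local Notation hL := hLv.1.
Local Notation ell := (ell Lv).
Variable n : nat.
Local Notation Q := {fraction R}.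
Local Notation V := (fracpow R n).
Local Notation "r %:F" := (@tofrac R r).
Variable phi : {linear 'rV[Q]_n -> 'rV[Q]_n}.
Local Notation psi := (restrict_scalars phi).
Local Notation T := (partial_trajectory psi).

(** The dimension increases at each extension, until it reaches [n]. *)
Lemma adapted_full : exists (B : 'M[Q]_n) C q, adapted v Lv phi B C q.
Proof.
suff : forall k, (k <= n)%N -> exists m (B : 'M[Q]_(m, n)) C q,
    (k <= m)%N /\ adapted v Lv phi B C q.
  move=> /(_ n (leqnn n))[m [B [C [q [nm aB]]]]].
  have mn : m = n.
    by apply/eqP; rewrite eqn_leq nm andbT -(eqP (adapted_free aB))
      rank_leq_col.
  by subst m; exists B, C, q.
elim=> [|k IH] kn.
  by exists 0%N, 0, 0, 1; split=> //; exact: adapted0.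
have [m [B [C [q [km aB]]]]] := IH (ltnW kn).
have [mn|nm] := ltnP m n.
  have [m' [B' [C' [q' [mm' aB']]]]] := adapted_extend hv hLv aB mn.
  by exists m', B', C', q'; split=> //; exact: leq_ltn_trans mm'.
by exists m, B, C, q; split=> //; exact: leq_trans nm.
Qed.

(** Primitive means of least leading value: at a coefficient of [q] of value
    zero, integrality of another multiple [s p_phi] says exactly that [v s] is
    at least the value of the leading coefficient of [q]. *)
Lemma lead_char_poly_value (B C : 'M[Q]_n) q p : adapted v Lv phi B C q ->
  is_char_poly_over v phi p -> v (lead_coef p)%:F = v (lead_coef q)%:F.
Proof.
move=> aB [s [sp smin]].
have Bu : B \in unitmx by rewrite -row_free_unit (adapted_free aB).
have CA := char_poly_similar Bu (adapted_stable aB).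
have qA : scaled_char_poly phi (lead_coef q) q.
  by rewrite /scaled_char_poly CA; exact: adapted_charpoly aB.
have -> : lead_coef p = s.
  apply: (@tofrac_inj R); have := congr1 lead_coef sp.
  rewrite lead_coefZ (monicP (char_poly_monic _)) mulr1 => <-.
  exact/esym/(lead_coef_map_inj (@tofrac_inj R) (raddf0 _)).
apply/le_anti; rewrite (smin _ _ qA)/=.
have [_ [i qi]] := adapted_primitive aB.
set f := char_poly (lin1_mx phi) in sp qA.
have : (0 <= v (p`_i)%:F)%E := valuation_ge0 hv _.
have -> : (p`_i)%:F = s%:F * f`_i by rewrite -coefZ -sp coef_map.
rewrite (valuationM hv).
have : v ((lead_coef q)%:F * f`_i) = 0%E by rewrite -coefZ -qA qi.
rewrite (valuationM hv); exact: le_of_cofactor (valuation_notNy hv _).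
Qed.

Lemma row_scaled m (G : 'M[Q]_(m, n)) (d : R) i :
  (row i (d%:F *: G) : V) = d *: (row i G : V).
Proof. by apply/rowP => j; rewrite !mxE. Qed.

Section FullLattice.
Variables (B C : 'M[Q]_n) (q : {poly R}) (s : K).
Hypothesis aB : adapted v Lv phi B C q.
Hypothesis qs : v (lead_coef q)%:F = s%:E.

Lemma ell_traj_adapted k : ell (T (lattice B) k.+1) (lattice B) = (k%:R * s)%:E.
Proof.
elim: k => [|k IH]; first by rewrite mul0r (ell_sub0 hL)// => x /traj1.
by rewrite (ell_trajS hL) IH (adapted_length aB) qs -EFinD -natr1 mulrDl mul1r.
Qed.

(** Let [F] be the lattice of [t] and [E] that of [B].  Multiplication by [d]
    takes the trajectory of [F] into that of [E].  It is injective modulo [H]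
    and [c E], for [c = d d'], because the vectors of the span of [H] that lie
    in [d' E] have integral coordinates on rows of [H].  The constant is the
    length of [E / c E]. *)
Lemma ell_traj_lattice r (t : 'M[Q]_(r, n)) (H : submodClosed V) :
  (forall i, (row i t : V) \in H) -> inert Lv psi H ->
  exists c : K, forall k, (ell (T (lattice t) k.+1) H <= (k%:R * s + c)%:E)%E.
Proof.
move=> tH iH.
have Bu : B \in unitmx by rewrite -row_free_unit (adapted_free aB).
have [m [G [GH Gmax]]] := rank_attained H.
have [d d0 [t' dt]] := common_denominator hv (t *m invmx B).
have [d' d'0 [P' dP]] := common_denominator hv (B *m pinvmx G).
pose E' := lattice ((d * d')%:F *: B).
have E'E x : x \in E' -> x \in lattice B.
  by apply: lattice_sub => i; rewrite row_scaled rpredZ// row_lattice.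
have fin : (ell (lattice B) E' < +oo)%E.
  apply: (ell_lattice_fin hv hLv) => i; exists (d * d');
    first by rewrite mulf_neq0.
  by rewrite -row_scaled; exact: row_lattice.
exists (fine (ell (lattice B) E')) => k.
have FH := lattice_sub tH.
(* Inertness makes the trajectory torsion over [H], so it stays in the span. *)
have TG x : x \in T (lattice t) k.+1 -> ((x : 'rV[Q]_n) <= G)%MS.
  move=> /(traj_sub FH) xT.
  have [r0 r00 /Gmax] := ell_torsion hv hLv (inert_traj_fin hL k iH) xT.
  by rewrite fracpowE eqmx_scale// tofrac_eq0.
rewrite EFinD -ell_traj_adapted fineK ?ge0_fin_numE ?(ell_ge0 hL)//.
rewrite addeC -(ell_chain hL (A := T (lattice B) k.+1) (B := lattice B))//;
  last first.
  by move=> x; exact: traj_base.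
apply: (ell_le_inj hL (f := *:%R d : {linear V -> V})) => x /=.
  move=> /mem_traj[h ht ->]; rewrite scaler_sumr; apply: rpred_sum => i _.
  rewrite -iter_linearZ; apply: traj_iter => //.
  have /mem_lattice[y ->] := ht i; apply/mem_lattice; exists (y *m t').
  rewrite map_mxM -dt fracpowE -scalemxAr -scalemxAl -mulmxA mulmxKV//.
move=> xT /mem_lattice[y dx]; apply: (lattice_sub GH).
have xE : (x : 'rV[Q]_n) = d'%:F *: (map_mx (@tofrac R) y *m B).
  have dF : d%:F != 0 by rewrite tofrac_eq0.
  have e : d%:F *: (x : 'rV[Q]_n) = map_mx (@tofrac R) y *m ((d * d')%:F *: B)
    := dx.
  by apply: (scalerI dF); rewrite e -scalemxAr rmorphM scalerA.
apply/mem_lattice; exists (y *m P').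
rewrite -[LHS](mulmxKpV (TG x xT)) {1}xE map_mxM -dP.
by rewrite -scalemxAr -!scalemxAl !mulmxA.
Qed.

(** Combines the two comparisons: [T_k H] with [H + T_k F], which costs [e] at
    each step, and [T_k F] with the trajectory of the adapted lattice. *)
Lemma inert_traj_bound (H : submodClosed V) (e : K) : inert Lv psi H -> 0 < e ->
  exists c : K, forall k, (ell (T H k.+1) H <= (k%:R * (e + s) + c)%:E)%E.
Proof.
move=> iH e0; have fin := (inertE hL psi H).1 iH.
have [m [g [gT gapp]]] := ell_fg_approx hL fin e0.
(* The lifted generators lie in [H + phi H]; their components under [phi]
   generate [F]. *)
have /choice[t tP] : forall i, exists t, t \in H /\ exists2 h,
  h \in H & g i = h + psi t.
  move=> i; have /traj_recl[t [h [/traj1 tH hH gE]]] := gT i.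
  by exists t; split=> //; exists h.
pose F := lattice (\matrix_i (t i : 'rV[Q]_n)).
have tH i : (row i (\matrix_i (t i : 'rV[Q]_n)) : V) \in H.
  by rewrite rowK; case: (tP i).
have FH : forall x, x \in F -> x \in H := lattice_sub tH.
pose S := submod_add (submod_im psi F) H.
have ST x : x \in S -> x \in T H 2.
  move=> /mem_submod_add[_ [h [/mem_submod_im[f fF ->] hH ->]]].
  by rewrite addrC; apply/traj_recl; exists f, h; split=> //; apply/traj1/FH.
have coreS : (ell (T H 2) S <= e%:E)%E.
  have gS i : g i \in S.
    have [ti [h hH ->]] := tP i; apply/mem_submod_add; exists (psi (t i)), h.
    split=> //; last by rewrite addrC.
    apply/mem_submod_im; exists (t i) => //.
    by have := row_lattice (\matrix_i (t i : 'rV[Q]_n)) i; rewrite rowK.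
  have HS x : x \in H -> x \in S by exact: submod_addr.
  have := gapp S gS; rewrite (ell_chain hL ST HS) leeD2lE//.
  rewrite ge0_fin_numE ?(ell_ge0 hL)//; apply: le_lt_trans fin.
  exact: (ell_mono hL).
have e0' : (0 <= e%:E)%E by rewrite lee_fin ltW.
have [c cP] := ell_traj_lattice tH iH.
exists c => k; rewrite (ell_chain hL (B := submod_add (T F k.+1) H)).
- rewrite (ell_addr hL) mulrDr addrAC -addrA addrC EFinD; apply: leeD.
    by rewrite addrC.
  by rewrite EFinM; exact: (ell_traj_core hL).
- move=> x /mem_submod_add[y [h [yF hH ->]]].
  by apply: rpredD; [exact: traj_sub yF|exact: traj_base].
- by move=> x; exact: submod_addr.
Qed.

End FullLattice.

End Entropy.

(** * The intrinsic entropy *)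

Local Open Scope classical_set_scope.

Section EntropyLimit.
Variables (R : pzRingType) (K : realType) (L : lmodType R -> \bar K).
Hypothesis hL : is_length_function L.
Variables (M : lmodType R) (phi : {linear M -> M}) (H : submodClosed M).
Hypothesis iH : inert L phi H.
Local Notation ell := (ell L).
Local Notation T := (partial_trajectory phi).

Definition growth (k : nat) : K := fine (ell (T H k.+2) (T H k.+1)).

Lemma growthE k : ell (T H k.+2) (T H k.+1) = (growth k)%:E.
Proof.
by rewrite fineK// ge0_fin_numE ?(ell_ge0 hL)//;
  exact: inert_step_fin.
Qed.

Lemma growth_cvg : cvgn growth.
Proof.
apply: nonincreasing_is_cvgn; last first.
  by exists 0 => _ [k _ <-]; apply: fine_ge0; exact: ell_ge0.
by apply/nonincreasing_seqP => k; rewrite -lee_fin -!growthE;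
  exact: ell_traj_step.
Qed.

Lemma ell_traj_sum k : ell (T H k.+1) H = (\sum_(i < k) growth i)%:E.
Proof.
elim: k => [|k IH]; first by rewrite big_ord0 (ell_sub0 hL)// => x /traj1.
by rewrite (ell_trajS hL) IH growthE big_ord_recr.
Qed.

Lemma mean_growth_cvg (l : K) : growth @ \oo --> l ->
  (fun k => (\sum_(i < k) growth i) * k.+1%:R^-1) @ \oo --> l.
Proof.
(* [k] increments are divided by [k + 1]: a zero prepended to the increments
   turns this into an arithmetic mean. *)
move=> gl; pose u k : K := if k is j.+1 then growth j else 0.
have ul : u @ \oo --> l by rewrite -(cvg_shiftS u).
rewrite (_ : (fun k => _) = arithmetic_mean u); first exact: cesaro.
apply/funext => k; rewrite /arithmetic_mean mulrC; congr (_ * _).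
by rewrite seriesEord /= big_ord_recl add0r.
Qed.

Lemma intrinsic_entropy_atE (l : K) : growth @ \oo --> l ->
  intrinsic_entropy_at L phi H = l%:E.
Proof.
move=> /mean_growth_cvg gl; apply: cvg_lim => //; rewrite -cvg_shiftS.
rewrite (_ : (fun k => _) = EFin \o (fun k =>
  (\sum_(i < k) growth i) * k.+1%:R^-1)).
  by apply: cvg_EFin => //; apply: nearW.
by apply/funext => k /=; rewrite -/(ell _ _) ell_traj_sum -EFinM.
Qed.

End EntropyLimit.

Section IntrinsicEntropy.
Variables (K : realType) (R : idomainType) (v : {fraction R} -> \bar K).
Hypothesis hv : is_nondiscrete_archimedean_valuation v.
Variable Lv : lmodType R -> \bar K.
Hypothesis hLv : is_valuation_length v Lv.
Local Notation hL := hLv.1.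
Variables (n : nat) (phi : {linear 'rV[{fraction R}]_n -> 'rV[{fraction R}]_n}).
Local Notation psi := (restrict_scalars phi).
Variables (B C : 'M[{fraction R}]_n) (q : {poly R}) (s : K).
Hypothesis aB : adapted v Lv phi B C q.
Hypothesis qs : v (tofrac (lead_coef q)) = s%:E.

Lemma inert_adapted : inert Lv psi (lattice B).
Proof. by apply/(inertE hL); rewrite (ell_traj_adapted hLv aB qs) ltry. Qed.

Lemma entropy_adapted : intrinsic_entropy_at Lv psi (lattice B) = s%:E.
Proof.
apply: (intrinsic_entropy_atE hL inert_adapted).
rewrite (_ : growth _ _ _ = fun=> s); first exact: cvg_cst.
by apply/funext => k; rewrite /growth (adapted_length aB) qs.
Qed.

Lemma entropy_at_le (H : submodClosed (fracpow R n)) : inert Lv psi H ->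
  (intrinsic_entropy_at Lv psi H <= s%:E)%E.
Proof.
move=> iH; have gl := growth_cvg hL iH; have ml := mean_growth_cvg gl.
rewrite (intrinsic_entropy_atE hL iH gl) lee_fin.
have s0 : 0 <= s by rewrite -lee_fin -qs (valuation_ge0 hv).
apply/ler_addgt0Pl => e e0.
have [c cP] := inert_traj_bound hv hLv aB qs iH e0.
have rhs : (fun k => (e + s) + `|c| * harmonic k) @ \oo --> (e + s) + `|c| * 0.
  by apply: cvgD; [exact: cvg_cst|apply: cvgM;
    [exact: cvg_cst|exact: cvg_harmonic]].
rewrite mulr0 addr0 in rhs.
apply: (ler_cvg_to ml rhs); apply: nearW => k.
have k0 : 0 < k.+1%:R :> K by [].
rewrite ler_pdivrMr// mulrDl -mulrA mulVf ?gt_eqF// mulr1.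
rewrite -lee_fin -(ell_traj_sum hL iH).
apply: le_trans (cP k) _; rewrite lee_fin; apply: lerD; last exact: ler_norm.
by rewrite mulrC ler_wpM2l ?ler_nat// addr_ge0// ltW.
Qed.

End IntrinsicEntropy.

Theorem theorem5p1 (K : realType) (R : idomainType) (v : {fraction R} -> \bar K)
    (hv : is_nondiscrete_archimedean_valuation v)
    (Lv : lmodType R -> \bar K) (hLv : is_valuation_length v Lv)
    (n : nat) (phi : {linear 'rV[{fraction R}]_n -> 'rV[{fraction R}]_n})
    (p : {poly R}) (hp : is_char_poly_over v phi p) :
  intrinsic_entropy Lv (restrict_scalars phi) = v (tofrac (lead_coef p)).
Proof.
have [B [C [q aB]]] := adapted_full hv hLv phi.
rewrite (lead_char_poly_value hv aB hp).
have qfin : v (tofrac (lead_coef q)) \is a fin_num.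
  rewrite (valuation_tofrac_fin hv)// lead_coef_eq0.
  exact: (primitive_neq0 hv (adapted_primitive aB)).
have qs := esym (fineK qfin).
rewrite qs; apply/le_anti/andP; split.
  by apply: ge_ereal_sup => _ [H iH <-]; exact: (entropy_at_le hv hLv aB qs iH).
rewrite -(entropy_adapted hLv aB qs); apply: ereal_sup_ubound.
by exists (lattice B) => //; exact: (inert_adapted hLv aB qs).
Qed.
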